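(* Let $\nu>-1/2$ and $\alpha,\lambda\in[0,1)$, and let $$\mathcal{Q}_\nu(z)=\int_0^z(2-S_\nu(t))\,dt,\qquad z\in\mathbb{D}.$$ Then $\mathcal{Q}_\nu\in\mathcal{L}^*_\lambda(\alpha)$ if and only if $$\lambda S_\nu''(1)+(2\lambda-\lambda\alpha+1)S_\nu'(1)+(1-\alpha)S_\nu(1)\le 2(1-\alpha).$$
   Context: Let $\mathbb{D}=\{z\in\mathbb{C}:|z|<1\}$. $\mathcal{A}$ denotes the class of functions $f$ analytic and univalent (injective) in $\mathbb{D}$, normalized by $f(0)=0$, $f'(0)=1$. $\mathcal{J}$ denotes the class of functions analytic in $\mathbb{D}$ of the form $f(z)=z-\sum_{n=2}^\infty b_nz^n$ with all $b_n>0$. For $\nu>-1$ the Bessel-Struve kernel function is the entire function $$S_\nu(z)=\sum_{n\ge 0}\frac{\Gamma(\nu+1)\,\Gamma\left(\frac{n+1}{2}\right)}{\sqrt{\pi}\,n!\,\Gamma\left(\frac n2+\nu+1\right)}z^n .$$ For $0\le\alpha<1$ and $0\le\lambda<1$, $$\mathcal{L}_\lambda(\alpha)=\left\{f\in\mathcal{A}:\ \operatorname{Re}\left(\frac{\lambda z^3f'''(z)+(1+2\lambda)z^2f''(z)+zf'(z)}{zf'(z)+\lambda z^2f''(z)}\right)>\alpha\ \text{ for all } z\in\mathbb{D}\right\},$$ where the quotient is understood to have the value $1$ at $z=0$ (removable singularity) and membership requires that the denominator does not vanish for $z\in\mathbb{D}\setminus\{0\}$ apart from removable singularities. Set $\mathcal{L}^*_\lambda(\alpha)=\mathcal{L}_\lambda(\alpha)\cap\mathcal{J}$.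 *)

(* Defs.v *)
(* Stdlib reals, with Coquelicot for complex numbers, limits and integrals. *)
From Stdlib Require Import Reals Factorial.
From Coquelicot Require Import Coquelicot.

Open Scope R_scope.

(* Euler's integral; it converges for 0 < x, the only range used below. *)
Definition Gamma (x : R) : R :=
  RInt_gen (fun t => Rpower t (x - 1) * exp (- t))
           (at_right 0) (Rbar_locally p_infty).

(* Complex counterpart of [PSeries]: the sum of [a n * z ^ n] over [n]. *)
Definition CPSeries (a : nat -> C) (z : C) : C :=
  iota (T := CompleteNormedModule.CompleteSpace _ C_CompleteNormedModule)
       (is_pseries (K := C_AbsRing) (V := C_NormedModule) a z).

(* [C_derive f z] is meaningful only where [f] is complex differentiable. *)
Definition C_Derive_n (n : nat) (f : C -> C) : C -> C :=
  Nat.iter n C_derive f.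

Definition CInt_segment (f : C -> C) (a b : C) : C :=
  ((b - a) *
   RInt (V := C_R_CompleteNormedModule)
        (fun t : R => f (a + RtoC t * (b - a))%C) 0 1)%C.

Definition in_disk (z : C) : Prop := Cmod z < 1.

Definition analytic_on_disk (f : C -> C) : Prop :=
  forall z : C, in_disk z ->
    ex_derive (K := C_AbsRing) (V := C_NormedModule) f z.

Definition univalent_on_disk (f : C -> C) : Prop :=
  forall z w : C, in_disk z -> in_disk w -> f z = f w -> z = w.

Definition class_A (f : C -> C) : Prop :=
  analytic_on_disk f /\ univalent_on_disk f /\
  f (RtoC 0) = RtoC 0 /\ C_derive f (RtoC 0) = RtoC 1.

(* The tail is indexed from 0, so its [n]-th term is [b (n+2) * z ^ (n+2)]. *)
Definition class_J (f : C -> C) : Prop :=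
  analytic_on_disk f /\
  exists b : nat -> R,
    (forall n : nat, (2 <= n)%nat -> 0 < b n) /\
    forall z : C, in_disk z ->
      exists s : C,
        is_series (K := C_AbsRing) (V := C_NormedModule)
          (fun n : nat => (RtoC (b (n + 2)%nat) * Cpow z (n + 2))%C) s /\
        f z = (z - s)%C.

Definition L_num (lambda : R) (f : C -> C) (z : C) : C :=
  (RtoC lambda * Cpow z 3 * C_Derive_n 3 f z
   + RtoC (1 + 2 * lambda) * Cpow z 2 * C_Derive_n 2 f z
   + z * C_Derive_n 1 f z)%C.

Definition L_den (lambda : R) (f : C -> C) (z : C) : C :=
  (z * C_Derive_n 1 f z + RtoC lambda * Cpow z 2 * C_Derive_n 2 f z)%C.

(* [q] is the quotient [L_num / L_den] with its removable singularities filled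
   in: zeros of the denominator are allowed only where the quotient extends
   analytically. [f'(0) = 1] prevents [L_den] from vanishing identically. *)
Definition class_L (lambda alpha : R) (f : C -> C) : Prop :=
  class_A f /\
  exists q : C -> C,
    analytic_on_disk q /\
    q (RtoC 0) = RtoC 1 /\
    (forall z : C, in_disk z -> L_den lambda f z <> RtoC 0 ->
       q z = (L_num lambda f z / L_den lambda f z)%C) /\
    (forall z : C, in_disk z -> alpha < Re (q z)).

Definition class_Lstar (lambda alpha : R) (f : C -> C) : Prop :=
  class_L lambda alpha f /\ class_J f.

Definition bessel_struve_coeff (nu : R) (n : nat) : R :=
  Gamma (nu + 1) * Gamma ((INR n + 1) / 2)
  / (sqrt PI * INR (fact n) * Gamma (INR n / 2 + nu + 1)).

Definition bessel_struve (nu : R) : C -> C :=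
  CPSeries (fun n : nat => RtoC (bessel_struve_coeff nu n)).

(* The integrand is entire, so the integral does not depend on the path. *)
Definition Q_fun (nu : R) (z : C) : C :=
  CInt_segment (fun t : C => (RtoC 2 - bessel_struve nu t)%C) (RtoC 0) z.

(* Main.v *)
Require Import Defs.
From Stdlib Require Import Reals Lra Lia Factorial FunctionalExtensionality.
From Coquelicot Require Import Coquelicot.

(** With [D = z f' + lambda z^2 f''] the numerator of the quotient is [z D'], so the
    class is the one of all [f] for which [D] is starlike of order [alpha].  For
    [f = z - sum b_n z^n] with [b_n > 0], Silverman's argument applies: the condition
    is [sum (n - alpha) d_n <= 1 - alpha], where [d_n = n (1 + lambda (n - 1)) b_n] are
    the coefficients of [z - D].
    Sufficiency compares [|z D' - D|] with [|D|] coefficientwise on [|z| = r]; for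
    necessity one lets [z = r] increase to [1] along the real axis, where [D] cannot
    vanish because the quotient would be unbounded at its first zero.
    For [Q_nu] one has [b_n = c_(n-1) / n] with [c_n] the coefficients of [S_nu], and the
    sum becomes the stated combination of [S_nu(1)], [S_nu'(1)] and [S_nu''(1)], since
    [c_0 = Gamma(1/2) / sqrt PI = 1]. *)

Open Scope R_scope.

(** * Entire power series with real coefficients *)

(** Because [S_nu] is entire, the argument can be run on coefficient sequences of infinite radius:
    the values at 1 are interior values, and letting [r] tend to 1 is plain continuity rather than a
    boundary theorem. With [e] the coefficients of [f'], one has [D = z * CPS u] for
    [u n = (lambda * n + 1) * e n], and the numerator is [z] times the series of [(n + 1) * u n].
    Cancelling [z] fills the removable singularity at 0. Membership also demands univalence. It is
    obtained directly: the criterion forces [f' > 0] on [0, 1), and negative coefficients then give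
    [|f z - f w - (z - w)| < |z - w|] for [z <> w]. The bound [nu > -1/2] enters through the growth
    of the [c_n]: it makes the quotient of Gamma values decrease when [n] grows by 2, so that
    [c_n = O(1 / n!)]. This rests on the functional equation of Gamma, and [c_0 = 1] rests on the
    Gaussian integral. *)

Notation is_Cseries := (is_series (K := C_AbsRing) (V := C_NormedModule)).
Notation is_Cderive := (is_derive (K := C_AbsRing) (V := C_NormedModule)).

Definition entire (a : nat -> R) : Prop := CV_radius a = p_infty.

Definition CPS (a : nat -> R) : C -> C := CPSeries (fun n => RtoC (a n)).

Lemma pow_n_Cpow (z : C) (n : nat) : pow_n (K := C_AbsRing) z n = Cpow z n.
Proof.
  induction n as [|n IH]; [reflexivity|].
  simpl. rewrite IH. reflexivity.
Qed.

Lemma is_Cpseries_iff (a : nat -> R) (z l : C) :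
  is_pseries (K := C_AbsRing) (V := C_NormedModule) (fun n => RtoC (a n)) z l
  <-> is_Cseries (fun n => (RtoC (a n) * Cpow z n)%C) l.
Proof.
  assert (H : forall n, scal (K := C_AbsRing) (V := C_NormedModule)
    (pow_n (K := C_AbsRing) z n) (RtoC (a n)) = (RtoC (a n) * Cpow z n)%C).
  { intros n. rewrite pow_n_Cpow. apply Cmult_comm. }
  split; apply is_series_ext; intros n; [|symmetry]; apply H.
Qed.

Lemma is_Cseries_unique (u : nat -> C) (l l' : C) :
  is_Cseries u l -> is_Cseries u l' -> l = l'.
Proof. apply (filterlim_locally_unique (V := C_NormedModule)). Qed.

(** [CPSeries] is a definite description, so an identity between values of [CPS] is proved by
    exhibiting a series that converges to the claimed sum. *)
Lemma CPS_unique (a : nat -> R) (z l : C) :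
  is_Cseries (fun n => (RtoC (a n) * Cpow z n)%C) l -> CPS a z = l.
Proof.
  intros Hl. unfold CPS, CPSeries.
  apply (iota_unique (V := C_CompleteNormedModule)).
  - intros y Hy. apply is_Cpseries_iff in Hy.
    exact (is_Cseries_unique _ _ _ Hy Hl).
  - now apply is_Cpseries_iff.
Qed.

Lemma entire_abs (a : nat -> R) (x : R) :
  entire a -> ex_series (fun n => Rabs (a n) * Rabs x ^ n).
Proof.
  intros Ha.
  apply ex_series_ext with (fun n => Rabs (a n * x ^ n)).
  - intros n. now rewrite Rabs_mult, RPow_abs.
  - apply CV_disk_inside. now rewrite Ha.
Qed.

Lemma entire_ex (a : nat -> R) (x : R) : entire a -> ex_pseries a x.
Proof. intros Ha. apply CV_radius_inside. now rewrite Ha. Qed.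

Lemma entire_is_series (a : nat -> R) (x : R) :
  entire a -> is_series (fun n => a n * x ^ n) (PSeries a x).
Proof. intros Ha. apply is_pseries_R, PSeries_correct, entire_ex, Ha. Qed.

Lemma CPS_is_series (a : nat -> R) (z : C) : entire a ->
  is_Cseries (fun n => (RtoC (a n) * Cpow z n)%C) (CPS a z).
Proof.
  intros Ha.
  assert (He : ex_series (K := C_AbsRing) (V := C_CompleteNormedModule)
                 (fun n => (RtoC (a n) * Cpow z n)%C)).
  { apply (ex_series_le (V := C_CompleteNormedModule))
      with (fun n => Rabs (a n) * Rabs (Cmod z) ^ n).
    - intros n. change (Cmod (RtoC (a n) * Cpow z n)%C <= Rabs (a n) * Rabs (Cmod z) ^ n).
      rewrite Cmod_mult, Cmod_pow, Cmod_R, (Rabs_pos_eq (Cmod z)).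
      + apply Rle_refl.
      + apply Cmod_ge_0.
    - now apply entire_abs. }
  destruct He as [l Hl]. change (is_Cseries (fun n => (RtoC (a n) * Cpow z n)%C) l) in Hl.
  now rewrite (CPS_unique _ _ _ Hl).
Qed.

Lemma Cmod_Cseries_le (u : nat -> C) (v : nat -> R) (s : C) (l : R) :
  is_Cseries u s -> is_series v l -> (forall n, Cmod (u n) <= v n) -> Cmod s <= l.
Proof.
  intros Hu Hv Huv.
  assert (H1 : filterlim (fun n => norm (sum_n u n)) eventually (locally (norm s))).
  { eapply filterlim_comp; [exact Hu|].
    apply (filterlim_norm (V := C_NormedModule)). }
  assert (H := is_lim_seq_le (fun n => norm (sum_n u n)) (fun n => sum_n v n)
                 (Cmod s) l).
  apply H.
  - intros n. eapply Rle_trans.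
    + apply (norm_sum_n_m (V := C_NormedModule)).
    + apply sum_n_m_le. exact Huv.
  - exact H1.
  - exact Hv.
Qed.

Lemma RtoC_is_series (u : nat -> R) (l : R) :
  is_series u l -> is_Cseries (fun n => RtoC (u n)) (RtoC l).
Proof.
  intros Hu.
  apply (filterlim_ext (fun n => RtoC (sum_n u n))).
  { intros n. induction n as [|n IH].
    - now rewrite !sum_O.
    - rewrite !sum_Sn, <- IH. unfold plus; simpl. apply RtoC_plus. }
  eapply filterlim_comp; [exact Hu|].
  (* Balls of [C] are here products of real balls, and both imaginary parts are 0. *)
  intros P [eps HP]. exists eps. intros y Hy. apply HP.
  split; [exact Hy|]. apply ball_center.
Qed.

Lemma CPS_RtoC (a : nat -> R) (x : R) :
  entire a -> CPS a (RtoC x) = RtoC (PSeries a x).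
Proof.
  intros Ha. apply CPS_unique.
  apply (is_series_ext (fun n => RtoC (a n * x ^ n))).
  - intros n. now rewrite RtoC_mult, RtoC_pow.
  - apply RtoC_is_series, entire_is_series, Ha.
Qed.

Lemma entire_plus (a b : nat -> R) :
  entire a -> entire b -> entire (PS_plus a b).
Proof.
  intros Ha Hb. unfold entire.
  assert (H := CV_radius_plus a b). rewrite Ha, Hb in H.
  destruct (CV_radius (PS_plus a b)); simpl in H; tauto.
Qed.

Lemma entire_scal (c : R) (a : nat -> R) : entire a -> entire (PS_scal c a).
Proof.
  intros Ha. destruct (Req_dec c 0) as [->|Hc].
  - unfold entire. rewrite <- CV_radius_const_0. apply CV_radius_ext.
    intros n. unfold PS_scal, scal; simpl; unfold mult; simpl. ring.
  - unfold entire. now rewrite CV_radius_scal.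
Qed.

Lemma entire_derive (a : nat -> R) : entire a -> entire (PS_derive a).
Proof. unfold entire. now rewrite CV_radius_derive. Qed.

Lemma entire_incr_1 (a : nat -> R) : entire a -> entire (PS_incr_1 a).
Proof. unfold entire. now rewrite CV_radius_incr_1. Qed.

Lemma entire_ext (a b : nat -> R) : (forall n, a n = b n) -> entire a -> entire b.
Proof. unfold entire. intros H <-. symmetry. now apply CV_radius_ext. Qed.

Lemma entire_of_ex_series (a : nat -> R) :
  (forall x, ex_series (fun n => Rabs (a n * x ^ n))) -> entire a.
Proof.
  intros Ha. unfold entire.
  assert (H : forall x, Rbar_le (Rabs x) (CV_radius a)).
  { intros x. apply Rbar_not_lt_le. intros Hlt.
    apply (CV_disk_outside _ _ Hlt). apply ex_series_lim_0, ex_series_Rabs, Ha. }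
  destruct (CV_radius a) as [r| |]; [|reflexivity|].
  - specialize (H (Rabs r + 1)). simpl in H.
    rewrite Rabs_pos_eq in H; [|generalize (Rabs_pos r); lra].
    generalize (Rle_abs r); lra.
  - specialize (H 0). simpl in H. contradiction.
Qed.

Lemma entire_Rabs (a : nat -> R) : entire a -> entire (fun n => Rabs (a n)).
Proof.
  intros Ha. apply entire_of_ex_series. intros x.
  apply ex_series_ext with (fun n => Rabs (a n) * Rabs x ^ n).
  - intros n. now rewrite Rabs_mult, Rabs_Rabsolu, RPow_abs.
  - now apply entire_abs.
Qed.

Lemma CPS_ext (a b : nat -> R) (z : C) : (forall n, a n = b n) -> CPS a z = CPS b z.
Proof. intros H. unfold CPS. f_equal. extensionality n. now rewrite H. Qed.

Lemma CPS_plus (a b : nat -> R) (z : C) : entire a -> entire b ->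
  CPS (PS_plus a b) z = (CPS a z + CPS b z)%C.
Proof.
  intros Ha Hb. apply CPS_unique.
  eapply is_series_ext;
    [|exact (is_series_plus _ _ _ _ (CPS_is_series a z Ha) (CPS_is_series b z Hb))].
  intros n. unfold PS_plus, plus; simpl. rewrite RtoC_plus.
  change ((a n * z ^ n + b n * z ^ n)%C = ((a n + b n) * z ^ n)%C). ring.
Qed.

Lemma CPS_scal (c : R) (a : nat -> R) (z : C) : entire a ->
  CPS (PS_scal c a) z = (RtoC c * CPS a z)%C.
Proof.
  intros Ha. apply CPS_unique.
  eapply is_series_ext;
    [|exact (is_series_scal (V := C_NormedModule) (RtoC c) _ _ (CPS_is_series a z Ha))].
  intros n. unfold PS_scal, scal; simpl. unfold mult; simpl. rewrite RtoC_mult. ring.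
Qed.

Lemma CPS_incr_1 (a : nat -> R) (z : C) : entire a ->
  CPS (PS_incr_1 a) z = (z * CPS a z)%C.
Proof.
  intros Ha. apply CPS_unique.
  apply is_series_decr_1.
  match goal with |- is_series _ ?l =>
    replace l with (scal (K := C_AbsRing) (V := C_NormedModule) z (CPS a z)) end.
  2:{ unfold plus, opp, scal; simpl. unfold mult, zero; simpl.
      change zero with (0%R). ring. }
  eapply is_series_ext;
    [|exact (is_series_scal (V := C_NormedModule) z _ _ (CPS_is_series a z Ha))].
  intros n. unfold scal; simpl. unfold mult; simpl. ring.
Qed.

(** The Euler operator [z d/dz] on coefficients. *)
Definition nmul (a : nat -> R) (n : nat) : R := INR n * a n.

Lemma nmul_incr_derive (a : nat -> R) (n : nat) : PS_incr_1 (PS_derive a) n = nmul a n.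
Proof.
  destruct n as [|n]; unfold nmul.
  - simpl. unfold zero; simpl. ring.
  - reflexivity.
Qed.

Lemma entire_nmul (a : nat -> R) : entire a -> entire (nmul a).
Proof.
  intros Ha. apply (entire_ext _ _ (nmul_incr_derive a)).
  now apply entire_incr_1, entire_derive.
Qed.

Lemma CPS_nmul (a : nat -> R) (z : C) :
  entire a -> CPS (nmul a) z = (z * CPS (PS_derive a) z)%C.
Proof.
  intros Ha. rewrite <- CPS_incr_1 by now apply entire_derive.
  apply CPS_ext. intros n. symmetry. apply nmul_incr_derive.
Qed.

(** * Termwise differentiation and integration *)

(** If [E] is the remainder for [n], the one for [n + 1] is [w * E + n * z^(n-1) * (w - z)^2]. The
    crude factor [n^2 * r^n] survives the induction because [1 <= r] absorbs the lost power of [r]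
    and [r * n^2 + n <= r * (n + 1)^2]. At [n = 0] the value of [pred] is harmless, being multiplied
    by 0. *)
Lemma Cpow_remainder (r : R) (z w : C) (n : nat) :
  1 <= r -> Cmod z <= r -> Cmod w <= r ->
  Cmod (Cpow w n - Cpow z n - RtoC (INR n) * Cpow z (pred n) * (w - z))%C
  <= INR n * (INR n * r ^ n) * Cmod (w - z)%C ^ 2.
Proof.
  intros Hr Hz Hw. induction n as [|n IH].
  - simpl. replace (1 - 1 - 0 * 1 * (w - z))%C with (RtoC 0) by ring.
    rewrite Cmod_0. lra.
  - set (E := (Cpow w n - Cpow z n - RtoC (INR n) * Cpow z (pred n) * (w - z))%C) in *.
    set (F := (RtoC (INR n) * Cpow z (pred n))%C).
    replace (Cpow w (S n) - Cpow z (S n)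
             - RtoC (INR (S n)) * Cpow z (pred (S n)) * (w - z))%C
      with (w * E + F * ((w - z) * (w - z)))%C.
    2:{ unfold E, F. rewrite S_INR, RtoC_plus. destruct n as [|n].
        - simpl. ring.
        - simpl pred. rewrite !Cpow_S. ring. }
    eapply Rle_trans; [apply Cmod_triangle|].
    rewrite !Cmod_mult.
    set (h := Cmod (w - z)%C) in *.
    assert (Hh : 0 <= h) by apply Cmod_ge_0.
    assert (HF : Cmod F <= INR n * r ^ n).
    { unfold F. rewrite Cmod_mult, Cmod_R, Cmod_pow, (Rabs_pos_eq (INR n)) by apply pos_INR.
      apply Rmult_le_compat_l; [apply pos_INR|].
      apply Rle_trans with (r ^ (pred n)).
      - apply pow_incr. split; [apply Cmod_ge_0|exact Hz].
      - apply Rle_pow; [exact Hr|lia]. }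
    assert (HE : Cmod w * Cmod E <= r * (INR n * (INR n * r ^ n) * h ^ 2)).
    { apply Rmult_le_compat; try apply Cmod_ge_0; assumption. }
    assert (HG : Cmod F * (h * h) <= INR n * r ^ n * (h * h)).
    { apply Rmult_le_compat_r; [nra|exact HF]. }
    assert (Hp : 0 <= r ^ n * (h * h)).
    { apply Rmult_le_pos; [apply pow_le; lra|nra]. }
    assert (Hn := pos_INR n). rewrite S_INR. simpl.
    set (N := INR n) in *. set (p := r ^ n) in *.
    replace (r * (N * (N * p) * h ^ 2)) with (r * N * N * (p * (h * h))) in HE by (simpl; ring).
    replace (N * p * (h * h)) with (N * (p * (h * h))) in HG by ring.
    replace ((N + 1) * ((N + 1) * (r * p)) * (h * (h * 1)))
      with (r * (N + 1) * (N + 1) * (p * (h * h))) by ring.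
    set (q := p * (h * h)) in *.
    assert (N * q <= r * (2 * N + 1) * q).
    { apply Rmult_le_compat_r; [exact Hp|]. nra. }
    nra.
Qed.

(* The constant is the majorant series of [n ^ 2 * |a n| * r ^ n]. *)
Lemma CPS_remainder (a : nat -> R) (r : R) : entire a -> 1 <= r ->
  exists M, 0 <= M /\ forall z w, Cmod z <= r -> Cmod w <= r ->
  Cmod (CPS a w - CPS a z - CPS (PS_derive a) z * (w - z))%C <= M * Cmod (w - z)%C ^ 2.
Proof.
  intros Ha Hr.
  set (b := nmul (nmul (fun n => Rabs (a n)))).
  assert (Hb : entire b) by now apply entire_nmul, entire_nmul, entire_Rabs.
  assert (Hpos : forall n, 0 <= b n * r ^ n).
  { intros n. unfold b, nmul.
    repeat apply Rmult_le_pos; try apply pos_INR; try apply Rabs_pos.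
    apply pow_le; lra. }
  exists (PSeries b r). split.
  { rewrite <- (is_series_unique (fun _ => 0) 0).
    - apply Series_le; [|exists (PSeries b r); now apply entire_is_series].
      intros n. split; [lra|apply Hpos].
    - apply is_series_Reals. intros eps Heps. exists 0%nat. intros n _.
      rewrite sum_eq_R0; [|reflexivity]. now rewrite R_dist_eq. }
  intros z w Hz Hw.
  (* The derivative series is shifted by one place, with a vanishing term at 0, so that it can be
     subtracted termwise from the two others. *)
  assert (Hd : is_Cseries
            (fun n => (RtoC (a n * INR n) * Cpow z (pred n) * (w - z))%C)
            (CPS (PS_derive a) z * (w - z))%C).
  { apply is_series_decr_1.
    match goal with |- is_series _ ?l =>
      replace l with (scal (K := C_AbsRing) (V := C_NormedModule) (w - z)%C
                        (CPS (PS_derive a) z)) end.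
    2:{ unfold plus, opp, scal; simpl. unfold mult; simpl. rewrite Rmult_0_r. ring. }
    eapply is_series_ext;
      [|exact (is_series_scal (V := C_NormedModule) (w - z)%C _ _
          (CPS_is_series _ z (entire_derive _ Ha)))].
    intros n. unfold PS_derive. rewrite Rmult_comm. apply Cmult_comm. }
  assert (Hs := is_series_minus _ _ _ _
    (is_series_minus _ _ _ _ (CPS_is_series a w Ha) (CPS_is_series a z Ha)) Hd).
  refine (Cmod_Cseries_le _ _ _ _ Hs
    (is_series_scal_r (Cmod (w - z)%C ^ 2) _ _ (entire_is_series b r Hb)) _).
  intros n.
  match goal with |- Cmod ?x <= _ => replace x with
    (RtoC (a n) * (Cpow w n - Cpow z n - RtoC (INR n) * Cpow z (pred n) * (w - z)))%C end.
  2:{ change ((RtoC (a n) * (Cpow w n - Cpow z n - RtoC (INR n) * Cpow z (pred n) * (w - z)))%C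
       = (RtoC (a n) * Cpow w n - RtoC (a n) * Cpow z n
          - RtoC (a n * INR n) * Cpow z (pred n) * (w - z))%C).
      rewrite RtoC_mult. ring. }
  rewrite Cmod_mult, Cmod_R. unfold b, nmul.
  replace (INR n * (INR n * Rabs (a n)) * r ^ n * Cmod (w - z)%C ^ 2)
    with (Rabs (a n) * (INR n * (INR n * r ^ n) * Cmod (w - z)%C ^ 2)) by ring.
  apply Rmult_le_compat_l; [apply Rabs_pos|].
  now apply Cpow_remainder.
Qed.

(** Reduces differentiability to an explicit quadratic error bound, which both power series and
    inversion provide. *)
Lemma is_Cderive_quadratic (f : C -> C) (z l : C) (d M : R) : 0 < d -> 0 <= M ->
  (forall w, Cmod (w - z)%C < d ->
     Cmod (f w - f z - l * (w - z))%C <= M * Cmod (w - z)%C ^ 2) ->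
  is_Cderive f z l.
Proof.
  intros Hd HM H. split; [apply is_linear_scal_l|].
  intros x Hx.
  apply (is_filter_lim_locally_unique (V := AbsRing_NormedModule C_AbsRing)) in Hx.
  subst x.
  intros eps.
  (* [M + 1] rather than [M], since [M] may be 0. *)
  assert (He : 0 < Rmin d (eps / (M + 1))).
  { apply Rmin_pos; [exact Hd|]. apply Rdiv_lt_0_compat; [apply cond_pos|lra]. }
  exists (mkposreal _ He). intros w Hw.
  change (Cmod (w - z)%C < Rmin d (eps / (M + 1))) in Hw.
  change (Cmod (f w - f z - (w - z) * l)%C <= eps * Cmod (w - z)%C).
  assert (H1 : Cmod (w - z)%C < d) by (eapply Rlt_le_trans; [exact Hw|apply Rmin_l]).
  assert (H2 : Cmod (w - z)%C < eps / (M + 1)) by (eapply Rlt_le_trans; [exact Hw|apply Rmin_r]).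
  rewrite (Cmult_comm (w - z)%C l).
  eapply Rle_trans; [now apply H|].
  assert (Hm := Cmod_ge_0 (w - z)%C).
  assert (Hpos := cond_pos eps).
  apply (Rmult_lt_compat_r (M + 1)) in H2; [|lra].
  unfold Rdiv in H2. rewrite Rmult_assoc, Rinv_l, Rmult_1_r in H2 by lra.
  nra.
Qed.

(** The version for curves: [CInt_segment] integrates over a real parameter, with [C] as a real
    normed module. *)
Lemma is_Rderive_quadratic (f : R -> C) (t : R) (l : C) (M : R) : 0 <= M ->
  (forall s, Rabs (s - t) < 1 ->
     Cmod (f s - f t - l * RtoC (s - t))%C <= M * (s - t) ^ 2) ->
  is_derive (K := R_AbsRing) (V := C_R_NormedModule) f t l.
Proof.
  intros HM H. split; [apply is_linear_scal_l|].
  intros x Hx.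
  apply (is_filter_lim_locally_unique (V := AbsRing_NormedModule R_AbsRing)) in Hx.
  subst x.
  intros eps.
  assert (He : 0 < Rmin 1 (eps / (M + 1))).
  { apply Rmin_pos; [lra|]. apply Rdiv_lt_0_compat; [apply cond_pos|lra]. }
  exists (mkposreal _ He). intros w Hw.
  change (Rabs (w - t) < Rmin 1 (eps / (M + 1))) in Hw.
  change (norm (K := R_AbsRing) (V := C_R_NormedModule)
    (minus (minus (f w) (f t)) (scal (w - t) l)) <= eps * Rabs (w - t)).
  rewrite <- Cmod_norm, scal_R_Cmult.
  change (Cmod (f w - f t - RtoC (w - t) * l)%C <= eps * Rabs (w - t)).
  assert (H1 : Rabs (w - t) < 1) by (eapply Rlt_le_trans; [exact Hw|apply Rmin_l]).
  assert (H2 : Rabs (w - t) < eps / (M + 1)) by (eapply Rlt_le_trans; [exact Hw|apply Rmin_r]).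
  rewrite (Cmult_comm (RtoC (w - t)) l).
  eapply Rle_trans; [now apply H|].
  rewrite <- (pow2_abs (w - t)).
  assert (Hm := Rabs_pos (w - t)).
  assert (Hpos := cond_pos eps).
  apply (Rmult_lt_compat_r (M + 1)) in H2; [|lra].
  unfold Rdiv in H2. rewrite Rmult_assoc, Rinv_l, Rmult_1_r in H2 by lra.
  nra.
Qed.

Lemma CPS_derive (a : nat -> R) (z : C) :
  entire a -> is_Cderive (CPS a) z (CPS (PS_derive a) z).
Proof.
  intros Ha.
  assert (Hz := Cmod_ge_0 z).
  destruct (CPS_remainder a (Cmod z + 1) Ha ltac:(lra)) as [M [HM H]].
  apply is_Cderive_quadratic with 1 M; [lra|exact HM|].
  intros w Hw. apply H; [lra|].
  replace w with (z + (w - z))%C by ring.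
  eapply Rle_trans; [apply Cmod_triangle|]. lra.
Qed.

Lemma C_derive_CPS (a : nat -> R) : entire a -> C_derive (CPS a) = CPS (PS_derive a).
Proof.
  intros Ha. extensionality z. apply is_C_derive_unique, CPS_derive, Ha.
Qed.

Lemma C_Derive_n_CPS (a : nat -> R) (n : nat) :
  entire a -> C_Derive_n n (CPS a) = CPS (Nat.iter n PS_derive a) /\
  entire (Nat.iter n PS_derive a).
Proof.
  intros Ha. induction n as [|n [IH1 IH2]]; [now split|].
  simpl. unfold C_Derive_n in *. simpl. rewrite IH1. split.
  - now apply C_derive_CPS.
  - now apply entire_derive.
Qed.

(* The two normed-module structures on [C] differ in their balls, but
   differentiability only involves the norm of the codomain. *)
Lemma is_Cderive_AbsRing (f : C -> C) (z l : C) :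
  is_Cderive f z l <->
  is_derive (K := C_AbsRing) (V := AbsRing_NormedModule C_AbsRing) f z l.
Proof.
  split; intros [_ H]; (split; [apply is_linear_scal_l|exact H]).
Qed.

(** The remainder is exactly [(w - z)^2 / (w * z^2)]. For [|w - z| < r / 2] one has [|w| >= r / 2],
    whence the constant [2 / r^3]. *)
Lemma is_Cderive_inv (z : C) : z <> RtoC 0 -> is_Cderive Cinv z (- / (z * z))%C.
Proof.
  intros Hz. assert (Hm := proj1 (Cmod_gt_0 z) Hz). set (r := Cmod z) in *.
  apply is_Cderive_quadratic with (r / 2) (2 / r ^ 3); [lra| |].
  { apply Rlt_le, Rdiv_lt_0_compat; [lra|]. now apply pow_lt. }
  intros w Hw.
  assert (Hwr : r / 2 <= Cmod w).
  { assert (H := Cmod_triangle w (z - w)%C).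
    replace (w + (z - w))%C with z in H by ring.
    replace (z - w)%C with (- (w - z))%C in H by ring.
    rewrite Cmod_opp in H. fold r in H. lra. }
  assert (Hw0 : w <> RtoC 0).
  { apply Cmod_gt_0. lra. }
  replace (/ w - / z - - / (z * z) * (w - z))%C
    with ((w - z) * (w - z) * / (w * (z * z)))%C by (field; split; assumption).
  rewrite !Cmod_mult, Cmod_inv, !Cmod_mult by (repeat apply Cmult_neq_0; assumption).
  fold r. set (h := Cmod (w - z)%C).
  replace (2 / r ^ 3 * h ^ 2) with (h * h * / (r / 2 * (r * r))) by (field; lra).
  apply Rmult_le_compat_l; [apply Rle_0_sqr|].
  apply Rinv_le_contravar.
  - apply Rmult_lt_0_compat; nra.
  - apply Rmult_le_compat_r; nra.
Qed.

Lemma ex_Cderive_div (f g : C -> C) (z : C) :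
  ex_derive (K := C_AbsRing) (V := C_NormedModule) f z ->
  ex_derive (K := C_AbsRing) (V := C_NormedModule) g z ->
  g z <> RtoC 0 ->
  ex_derive (K := C_AbsRing) (V := C_NormedModule) (fun x => f x / g x)%C z.
Proof.
  intros [df Hf] [dg Hg] Hz.
  apply is_Cderive_AbsRing in Hf, Hg.
  assert (Hi := proj1 (is_Cderive_AbsRing _ _ _) (is_Cderive_inv (g z) Hz)).
  assert (Hc := is_derive_comp _ _ _ _ _ Hi Hg).
  assert (Hm := is_derive_mult _ _ _ _ _ Hf Hc Cmult_comm).
  eexists. apply is_Cderive_AbsRing. exact Hm.
Qed.

Lemma ex_Cderive_continuous (f : C -> C) (z : C) (eps : R) :
  ex_derive (K := C_AbsRing) (V := C_NormedModule) f z -> 0 < eps ->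
  exists d, 0 < d /\ forall w, Cmod (w - z)%C < d -> Cmod (f w - f z)%C < eps.
Proof.
  intros [l Hl] He. apply is_Cderive_AbsRing in Hl.
  assert (Hc := ex_derive_continuous (V := AbsRing_NormedModule C_AbsRing) f z (ex_intro _ l Hl)).
  destruct (proj1 (filterlim_locally _ _) Hc (mkposreal eps He)) as [d Hd].
  exists d. split; [apply cond_pos|]. exact Hd.
Qed.

(** Used with [k = / z] to produce the primitive along a segment, and with [k = 1] for the
    continuity of the integrand. *)
Lemma is_derive_CPS_ray (a : nat -> R) (k z : C) (t : R) : entire a ->
  is_derive (K := R_AbsRing) (V := C_R_NormedModule)
    (fun s : R => (k * CPS a (RtoC s * z))%C) t (k * (CPS (PS_derive a) (RtoC t * z) * z))%C.
Proof.
  intros Ha.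
  assert (Hz := Cmod_ge_0 z). assert (Hk := Cmod_ge_0 k). assert (Ht := Rabs_pos t).
  (* This radius contains [s * z] whenever [|s - t| < 1]; the final [+ 1] makes it at least 1. *)
  destruct (CPS_remainder a ((Rabs t + 1) * Cmod z + 1) Ha) as [M [HM H]]; [nra|].
  apply is_Rderive_quadratic with (Cmod k * (M * Cmod z ^ 2)).
  { apply Rmult_le_pos; [exact Hk|]. apply Rmult_le_pos; [exact HM|]. nra. }
  intros s Hs.
  assert (Hst : Rabs s <= Rabs t + 1).
  { replace s with (t + (s - t)) by ring.
    eapply Rle_trans; [apply Rabs_triang|]. lra. }
  assert (H1 : Cmod (RtoC t * z) <= (Rabs t + 1) * Cmod z + 1).
  { rewrite Cmod_mult, Cmod_R. nra. }
  assert (H2 : Cmod (RtoC s * z) <= (Rabs t + 1) * Cmod z + 1).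
  { rewrite Cmod_mult, Cmod_R. nra. }
  specialize (H _ _ H1 H2).
  replace (RtoC s * z - RtoC t * z)%C with (RtoC (s - t) * z)%C in H
    by (rewrite RtoC_minus; ring).
  match goal with |- Cmod ?x <= _ => replace x with
    (k * (CPS a (RtoC s * z) - CPS a (RtoC t * z)
          - CPS (PS_derive a) (RtoC t * z) * (RtoC (s - t) * z)))%C by ring end.
  rewrite Cmod_mult. rewrite (Cmod_mult (RtoC (s - t))), Cmod_R in H.
  rewrite Rmult_assoc. apply Rmult_le_compat_l; [exact Hk|].
  rewrite Rpow_mult_distr, pow2_abs in H.
  eapply Rle_trans; [exact H|]. right. ring.
Qed.

Lemma CInt_segment_CPS (a : nat -> R) (z : C) : entire a ->
  CInt_segment (CPS (PS_derive a)) (RtoC 0) z = (CPS a z - CPS a (RtoC 0))%C.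
Proof.
  intros Ha. unfold CInt_segment.
  (* The primitive below is divided by [z], so [z = 0] is treated apart. *)
  destruct (Ceq_dec z (RtoC 0)) as [->|Hz].
  { match goal with |- ?x = ?y => change (@eq C x y) end. ring. }
  assert (HI : is_RInt (V := C_R_CompleteNormedModule)
     (fun t : R => CPS (PS_derive a) (RtoC 0 + RtoC t * (z - RtoC 0))%C) 0 1
     (/ z * CPS a (RtoC 1 * z) - / z * CPS a (RtoC 0 * z))%C).
  { assert (Hext : forall t : R,
      CPS (PS_derive a) (RtoC 0 + RtoC t * (z - RtoC 0))%C
      = (/ z * (CPS (PS_derive a) (RtoC t * z) * z))%C).
    { intros t. replace (RtoC 0 + RtoC t * (z - RtoC 0))%C with (RtoC t * z)%C by ring.
      match goal with |- ?x = ?y => change (@eq C x y) end. field. exact Hz. }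
    apply (is_RInt_derive (V := C_R_CompleteNormedModule)
      (fun t : R => (/ z * CPS a (RtoC t * z))%C)).
    - intros t _. rewrite Hext. now apply is_derive_CPS_ray.
    - intros t _.
      apply (continuous_ext (fun t : R => (RtoC 1 * CPS (PS_derive a) (RtoC t * z))%C)).
      { intros s. rewrite Hext.
        match goal with |- ?x = ?y => change (@eq C x y) end. field. exact Hz. }
      apply (ex_derive_continuous (V := C_R_NormedModule)).
      eexists. apply is_derive_CPS_ray. now apply entire_derive. }
  rewrite (is_RInt_unique _ _ _ _ HI).
  replace (RtoC 1 * z)%C with z by ring.
  replace (RtoC 0 * z)%C with (RtoC 0) by ring. field. exact Hz.
Qed.

(** * Comparison and monotonicity of power series *)

Lemma CPS_0 (a : nat -> R) : entire a -> CPS a (RtoC 0) = RtoC (a 0%nat).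
Proof. intros Ha. rewrite CPS_RtoC by exact Ha. now rewrite PSeries_0. Qed.

Lemma entire_decr_1 (a : nat -> R) : entire a -> entire (PS_decr_1 a).
Proof. unfold entire. now rewrite CV_radius_decr_1. Qed.

Lemma PSeries_le (a b : nat -> R) (x : R) : entire a -> entire b -> 0 <= x ->
  (forall n, a n <= b n) -> PSeries a x <= PSeries b x.
Proof.
  intros Ha Hb Hx H.
  apply (is_lim_seq_le (fun n => sum_n (fun k => a k * x ^ k) n)
                       (fun n => sum_n (fun k => b k * x ^ k) n)
                       (PSeries a x) (PSeries b x)).
  - intros n. apply sum_n_m_le. intros k.
    apply Rmult_le_compat_r; [now apply pow_le|apply H].
  - exact (entire_is_series a x Ha).
  - exact (entire_is_series b x Hb).
Qed.

Lemma PSeries_incr (a : nat -> R) (x y : R) : entire a ->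
  (forall n, 0 <= a n) -> 0 <= x <= y -> PSeries a x <= PSeries a y.
Proof.
  intros Ha H Hxy.
  apply (is_lim_seq_le (fun n => sum_n (fun k => a k * x ^ k) n)
                       (fun n => sum_n (fun k => a k * y ^ k) n)
                       (PSeries a x) (PSeries a y)).
  - intros n. apply sum_n_m_le. intros k.
    apply Rmult_le_compat_l; [apply H|now apply pow_incr].
  - exact (entire_is_series a x Ha).
  - exact (entire_is_series a y Ha).
Qed.

Lemma PSeries_ge_first (a : nat -> R) (x : R) : entire a ->
  (forall n, 0 <= a n) -> 0 <= x -> a 0%nat <= PSeries a x.
Proof.
  intros Ha H Hx. rewrite <- (PSeries_0 a).
  apply PSeries_incr; [exact Ha|exact H|lra].
Qed.

(** Write [w(t) = w_0 - t * s(t)] with [s] of positive coefficients: [s] is positive and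
    nondecreasing, and the factor [t] gives strictness. *)
Lemma PSeries_decreasing (w : nat -> R) (x y : R) : entire w ->
  (forall n, w (S n) < 0) -> 0 <= x < y -> PSeries w y < PSeries w x.
Proof.
  intros Hw Hneg Hxy.
  set (s := PS_scal (-1) (PS_decr_1 w)).
  assert (Hs : entire s) by now apply entire_scal, entire_decr_1.
  assert (Hs0 : forall n, 0 < s n).
  { intros n. unfold s, PS_scal, PS_decr_1, scal; simpl; unfold mult; simpl.
    generalize (Hneg n). lra. }
  assert (Heq : forall t, PSeries w t = w 0%nat - t * PSeries s t).
  { intros t. rewrite PSeries_decr_1 by now apply entire_ex.
    unfold s. rewrite PSeries_scal. ring. }
  assert (H1 : PSeries s x <= PSeries s y).
  { apply PSeries_incr; [exact Hs| |lra]. intros n. now apply Rlt_le. }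
  assert (H2 : 0 < PSeries s y).
  { apply Rlt_le_trans with (s 0%nat); [apply Hs0|].
    apply PSeries_ge_first; [exact Hs| |lra]. intros n. now apply Rlt_le. }
  rewrite !Heq. nra.
Qed.

Lemma Cmod_CPS_le (a b : nat -> R) (z : C) : entire a -> entire b ->
  (forall n, Rabs (a n) <= b n) -> Cmod (CPS a z) <= PSeries b (Cmod z).
Proof.
  intros Ha Hb H.
  refine (Cmod_Cseries_le _ _ _ _ (CPS_is_series a z Ha)
            (entire_is_series b (Cmod z) Hb) _).
  intros n. rewrite Cmod_mult, Cmod_R, Cmod_pow.
  apply Rmult_le_compat_r; [apply pow_le, Cmod_ge_0|apply H].
Qed.

Lemma CPS_decr_1 (a : nat -> R) (z : C) : entire a ->
  CPS a z = (RtoC (a 0%nat) + z * CPS (PS_decr_1 a) z)%C.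
Proof.
  intros Ha. apply CPS_unique. apply is_series_decr_1.
  match goal with |- is_series _ ?l =>
    replace l with (scal (K := C_AbsRing) (V := C_NormedModule) z (CPS (PS_decr_1 a) z)) end.
  2:{ unfold plus, opp, scal; simpl. unfold mult; simpl. ring. }
  eapply is_series_ext;
    [|exact (is_series_scal (V := C_NormedModule) z _ _
        (CPS_is_series _ z (entire_decr_1 _ Ha)))].
  intros n. unfold scal, PS_decr_1; simpl. unfold mult; simpl. ring.
Qed.

(** * Functions starlike of order [alpha] with negative coefficients *)

Lemma continuity_pt_pos (f : R -> R) (x : R) : continuity_pt f x -> 0 < f x ->
  exists d, 0 < d /\ forall y, Rabs (y - x) < d -> 0 < f y.
Proof.
  intros Hc Hx. destruct (Hc (f x) Hx) as [d [Hd H]].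
  exists d. split; [exact Hd|]. intros y Hy.
  destruct (Req_dec y x) as [->|Hyx]; [exact Hx|].
  assert (H1 := H y (conj (conj I (not_eq_sym Hyx)) Hy)).
  simpl in H1. unfold Rdist in H1. apply Rabs_def2 in H1. lra.
Qed.

Lemma entire_continuity (a : nat -> R) : entire a -> continuity (PSeries a).
Proof. intros Ha x. apply PSeries_continuity. now rewrite Ha. Qed.

(** Coefficients of [c * z * a' + d * a]. The denominator, the numerator and the criterion are all
    obtained by iterating this operator. *)
Definition affmul (c d : R) (a : nat -> R) (n : nat) : R := (c * INR n + d) * a n.

Lemma entire_affine (a : nat -> R) (c d : R) : entire a ->
  entire (affmul c d a).
Proof.
  intros Ha.
  apply (entire_ext (PS_plus (PS_scal c (nmul a)) (PS_scal d a))).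
  - intros n. unfold PS_plus, PS_scal, affmul, nmul, plus, scal; simpl; unfold mult; simpl. ring.
  - now apply entire_plus; apply entire_scal; [apply entire_nmul|].
Qed.

Lemma CPS_affine (a : nat -> R) (c d : R) (z : C) : entire a ->
  CPS (affmul c d a) z
  = (RtoC c * (z * CPS (PS_derive a) z) + RtoC d * CPS a z)%C.
Proof.
  intros Ha. rewrite <- CPS_nmul, <- !CPS_scal, <- CPS_plus
    by auto using entire_nmul, entire_scal.
  apply CPS_ext. intros n.
  unfold PS_plus, PS_scal, affmul, nmul, plus, scal; simpl; unfold mult; simpl. ring.
Qed.

Lemma PSeries_affine (a : nat -> R) (c d x : R) : entire a ->
  PSeries (affmul c d a) x = c * PSeries (nmul a) x + d * PSeries a x.
Proof.
  intros Ha. rewrite <- !PSeries_scal, <- PSeries_plus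
    by now apply entire_ex, entire_scal; try apply entire_nmul.
  apply PSeries_ext. intros n.
  unfold PS_plus, PS_scal, affmul, nmul, plus, scal; simpl; unfold mult; simpl. ring.
Qed.

Lemma PSeries_nmul_neg (u : nat -> R) (r : R) : entire u ->
  (forall n, u (S n) < 0) -> 0 < r -> PSeries (nmul u) r < 0.
Proof.
  intros Hu Hneg Hr.
  replace 0 with (PSeries (nmul u) 0).
  - apply PSeries_decreasing; [now apply entire_nmul| |lra].
    intros n. unfold nmul. assert (H := pos_INR n). rewrite S_INR.
    generalize (Hneg n). nra.
  - rewrite PSeries_0. unfold nmul. simpl. ring.
Qed.

(* At a zero [r] of the denominator in [(0, 1)] the numerator is negative, so the
   quotient could not stay bounded near [r]. *)
Lemma starlike_den_pos (u : nat -> R) (q : C -> C) (r : R) :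
  entire u -> u 0%nat = 1 -> (forall n, u (S n) < 0) ->
  analytic_on_disk q ->
  (forall z, in_disk z -> CPS u z <> RtoC 0 -> z <> RtoC 0 ->
     q z = (CPS (affmul 1 1 u) z / CPS u z)%C) ->
  0 <= r < 1 -> 0 < PSeries u r.
Proof.
  intros Hu H0 Hneg Hq Hquot Hr.
  apply Rnot_le_lt. intros Hle.
  assert (HU0 : PSeries u 0 = 1) by now rewrite PSeries_0.
  destruct (IVT_cor (PSeries u) 0 r (entire_continuity u Hu) (proj1 Hr)) as [s [Hs Hus]].
  { rewrite HU0. lra. }
  assert (Hs0 : 0 < s).
  { destruct (Req_dec s 0) as [E|E]; [|lra]. rewrite E, HU0 in Hus. lra. }
  set (v := affmul 1 1 u) in *.
  assert (Hv : entire v) by now apply entire_affine.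
  assert (Hvs : PSeries v s < 0).
  { unfold v. rewrite PSeries_affine, Hus by exact Hu.
    generalize (PSeries_nmul_neg u s Hu Hneg Hs0). lra. }
  assert (Hsd : in_disk (RtoC s)).
  { unfold in_disk. rewrite Cmod_R, Rabs_pos_eq; lra. }
  destruct (ex_Cderive_continuous q (RtoC s) 1 (Hq _ Hsd) Rlt_0_1) as [d [Hd Hqc]].
  set (B := Cmod (q (RtoC s)) + 1).
  assert (HB : 0 < B) by (unfold B; generalize (Cmod_ge_0 (q (RtoC s))); lra).
  (* Positivity of this function at points where [u > 0] says [v / u < - B], against the bound [B]
     for [|q|] near [s]. *)
  destruct (continuity_pt_pos (fun x => - PSeries v x - B * PSeries u x) s) as [d' [Hd' Hpos]].
  { apply continuity_pt_minus.
    - apply continuity_pt_opp, entire_continuity, Hv.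
    - apply continuity_pt_scal, entire_continuity, Hu. }
  { rewrite Hus. lra. }
  (* A point of (0, s) in both neighbourhoods; to the left of its zero the decreasing [u] is
     positive, so the quotient formula applies there. *)
  set (t := s - Rmin (s / 2) (Rmin (d / 2) (d' / 2))).
  assert (Ht : 0 < t < s /\ s - t < d /\ s - t < d').
  { unfold t.
    assert (0 < Rmin (s / 2) (Rmin (d / 2) (d' / 2))) by (repeat apply Rmin_pos; lra).
    generalize (Rmin_l (s / 2) (Rmin (d / 2) (d' / 2)))
      (Rmin_r (s / 2) (Rmin (d / 2) (d' / 2))) (Rmin_l (d / 2) (d' / 2))
      (Rmin_r (d / 2) (d' / 2)). lra. }
  assert (Hut : 0 < PSeries u t).
  { rewrite <- Hus. apply PSeries_decreasing; [exact Hu|exact Hneg|lra]. }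
  assert (Hqt : Cmod (q (RtoC t)) <= B).
  { assert (H := Hqc (RtoC t)). rewrite <- RtoC_minus, Cmod_R, Rabs_minus_sym in H.
    rewrite Rabs_pos_eq in H by lra. specialize (H (proj1 (proj2 Ht))).
    replace (q (RtoC t)) with ((q (RtoC t) - q (RtoC s)) + q (RtoC s))%C by ring.
    eapply Rle_trans; [apply Cmod_triangle|]. unfold B. lra. }
  assert (Heq : q (RtoC t) = RtoC (PSeries v t / PSeries u t)).
  { rewrite RtoC_div by lra. rewrite <- !CPS_RtoC by assumption.
    apply Hquot.
    - unfold in_disk. rewrite Cmod_R, Rabs_pos_eq; lra.
    - rewrite CPS_RtoC by exact Hu. intros E. apply RtoC_inj in E. lra.
    - intros E. apply RtoC_inj in E. lra. }
  rewrite Heq, Cmod_R in Hqt.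
  assert (H1 := Hpos t). rewrite Rabs_minus_sym, Rabs_pos_eq in H1 by lra.
  specialize (H1 (proj2 (proj2 Ht))).
  assert (H2 : - (PSeries v t / PSeries u t) <= B).
  { eapply Rle_trans; [|exact Hqt]. rewrite <- Rabs_Ropp. apply Rle_abs. }
  apply (Rmult_le_compat_r (PSeries u t)) in H2; [|lra].
  replace (- (PSeries v t / PSeries u t) * PSeries u t) with (- PSeries v t) in H2
    by (field; lra).
  lra.
Qed.

(** Multiplying [alpha < v(t) / u(t)] by [u(t) > 0] gives [v(t) - alpha * u(t) > 0], and for
    [v = affmul 1 1 u] the left side is the series of [affmul 1 (1 - alpha) u]. A negative value at
    1 would persist slightly to the left of 1. *)
Lemma starlike_necessary (u : nat -> R) (alpha : R) (q : C -> C) :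
  entire u -> u 0%nat = 1 -> (forall n, u (S n) < 0) ->
  analytic_on_disk q ->
  (forall z, in_disk z -> CPS u z <> RtoC 0 -> z <> RtoC 0 ->
     q z = (CPS (affmul 1 1 u) z / CPS u z)%C) ->
  (forall z, in_disk z -> alpha < Re (q z)) ->
  0 <= PSeries (affmul 1 (1 - alpha) u) 1.
Proof.
  intros Hu H0 Hneg Hq Hquot Hre.
  set (w := affmul 1 (1 - alpha) u).
  assert (Hw : entire w) by now apply entire_affine.
  apply Rnot_lt_le. intros Hlt.
  destruct (continuity_pt_pos (fun x => - PSeries w x) 1) as [d [Hd Hpos]].
  { apply continuity_pt_opp, entire_continuity, Hw. }
  { lra. }
  set (t := 1 - Rmin (1 / 2) (d / 2)).
  assert (Ht : 0 < t < 1 /\ 1 - t < d).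
  { unfold t. assert (0 < Rmin (1 / 2) (d / 2)) by (apply Rmin_pos; lra).
    generalize (Rmin_l (1 / 2) (d / 2)) (Rmin_r (1 / 2) (d / 2)). lra. }
  assert (H1 := Hpos t). rewrite Rabs_minus_sym, Rabs_pos_eq in H1 by lra.
  specialize (H1 (proj2 Ht)).
  assert (Hut : 0 < PSeries u t).
  { apply (starlike_den_pos u q t); try assumption. lra. }
  assert (Hd1 : in_disk (RtoC t)).
  { unfold in_disk. rewrite Cmod_R, Rabs_pos_eq; lra. }
  assert (H2 := Hre _ Hd1).
  rewrite Hquot in H2; [| exact Hd1 | |].
  - rewrite !CPS_RtoC, <- RtoC_div in H2 by (try lra; try apply entire_affine; exact Hu).
    change (alpha < PSeries (affmul 1 1 u) t / PSeries u t) in H2.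
    apply (Rmult_lt_compat_r (PSeries u t)) in H2; [|exact Hut].
    unfold Rdiv in H2. rewrite Rmult_assoc, Rinv_l, Rmult_1_r in H2 by lra.
    unfold w in H1. rewrite PSeries_affine in H1, H2 by exact Hu. lra.
  - rewrite CPS_RtoC by exact Hu. intros E. apply RtoC_inj in E. lra.
  - intros E. apply RtoC_inj in E. lra.
Qed.

(* On [|z| = r], [|h - g| <= g r - h r < (1 - alpha) g r <= (1 - alpha) |g|] for the
   denominator [g] and the numerator [h]. *)
Lemma starlike_sufficient (u : nat -> R) (alpha : R) (z : C) :
  entire u -> u 0%nat = 1 -> (forall n, u (S n) < 0) -> alpha < 1 ->
  0 <= PSeries (affmul 1 (1 - alpha) u) 1 ->
  in_disk z ->
  CPS u z <> RtoC 0 /\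
  alpha < Re (CPS (affmul 1 1 u) z / CPS u z)%C.
Proof.
  intros Hu H0 Hneg Hal Hcond Hz.
  set (r := Cmod z). assert (Hr : 0 <= r < 1) by (split; [apply Cmod_ge_0|exact Hz]).
  (* The criterion allows equality at 1; strict monotonicity turns it into a strict inequality at
     [r < 1]. *)
  assert (Hw : 0 < PSeries (affmul 1 (1 - alpha) u) r).
  { eapply Rle_lt_trans; [exact Hcond|]. apply PSeries_decreasing; [|intros n|lra].
    - now apply entire_affine.
    - unfold affmul. rewrite S_INR. generalize (Hneg n) (pos_INR n). nra. }
  rewrite PSeries_affine in Hw by exact Hu.
  assert (Hn : PSeries (nmul u) r <= 0).
  { destruct (Req_dec r 0) as [->|E].
    - rewrite PSeries_0. unfold nmul. simpl. lra.
    - apply Rlt_le, PSeries_nmul_neg; [exact Hu|exact Hneg|lra]. }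
  assert (Hnm : Cmod (CPS (nmul u) z) <= - PSeries (nmul u) r).
  { replace (- PSeries (nmul u) r) with (PSeries (PS_scal (-1) (nmul u)) r)
      by (rewrite PSeries_scal; ring).
    apply Cmod_CPS_le; [now apply entire_nmul|now apply entire_scal, entire_nmul|].
    intros n. unfold PS_scal, scal; simpl; unfold mult, nmul; simpl.
    destruct n as [|n]; [simpl; rewrite Rmult_0_l, Rabs_R0; lra|].
    assert (INR (S n) * u (S n) <= 0).
    { assert (H := pos_INR (S n)). generalize (Hneg n). nra. }
    rewrite Rabs_left1 by assumption. lra. }
  (* From [u(z) = 1 + z * c(z)] with [c] of negative coefficients: [|u(z)| >= 1 - r * |c(z)|], and
     [|c(z)|] is at most [- c(r)]. *)
  assert (Hg : PSeries u r <= Cmod (CPS u z)).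
  { set (c := PS_decr_1 u). assert (Hc : entire c) by now apply entire_decr_1.
    assert (E : PSeries u r = 1 - r * PSeries (PS_scal (-1) c) r).
    { rewrite PSeries_decr_1 by now apply entire_ex.
      rewrite H0, PSeries_scal. fold c. ring. }
    assert (Hcz : Cmod (CPS c z) <= PSeries (PS_scal (-1) c) r).
    { apply Cmod_CPS_le; [exact Hc|now apply entire_scal|].
      intros n. unfold PS_scal, scal; simpl; unfold mult; simpl.
      unfold c, PS_decr_1. rewrite Rabs_left by apply Hneg. lra. }
    assert (Ht := Cmod_triangle (CPS u z) (- (z * CPS c z))%C).
    rewrite CPS_decr_1, H0 in Ht by exact Hu. fold c in Ht.
    replace (RtoC 1 + z * CPS c z + - (z * CPS c z))%C with (RtoC 1) in Ht by ring.
    rewrite Cmod_1, Cmod_opp, Cmod_mult in Ht. fold r in Ht.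
    rewrite CPS_decr_1, H0 by exact Hu. fold c.
    assert (r * Cmod (CPS c z) <= r * PSeries (PS_scal (-1) c) r)
      by (apply Rmult_le_compat_l; lra).
    lra. }
  assert (Hg0 : 0 < PSeries u r) by nra.
  assert (Hnz : CPS u z <> RtoC 0) by (apply Cmod_gt_0; lra).
  split; [exact Hnz|].
  rewrite CPS_affine, <- CPS_nmul by exact Hu.
  replace ((RtoC 1 * CPS (nmul u) z + RtoC 1 * CPS u z) / CPS u z)%C
    with (RtoC 1 + CPS (nmul u) z / CPS u z)%C by (field; exact Hnz).
  set (x := (CPS (nmul u) z / CPS u z)%C).
  assert (Hx : Cmod x < 1 - alpha).
  { unfold x. rewrite Cmod_div by exact Hnz.
    apply Rmult_lt_reg_r with (Cmod (CPS u z)); [lra|].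
    unfold Rdiv. rewrite Rmult_assoc, Rinv_l, Rmult_1_r by lra. nra. }
  change (alpha < 1 + Re x).
  assert (Hre := re_le_Cmod x).
  assert (Hab := Rle_abs (- Re x)). rewrite Rabs_Ropp in Hab. lra.
Qed.

(** * Primitives of entire series and membership in the function classes *)

Lemma entire_Int (e : nat -> R) : entire e -> entire (PS_Int e).
Proof. unfold entire. now rewrite CV_radius_Int. Qed.

Lemma PS_derive_Int (e : nat -> R) : PS_derive (PS_Int e) = e.
Proof.
  extensionality n. unfold PS_derive, PS_Int. field.
  apply not_0_INR. discriminate.
Qed.

(** The factor [INR (S n)] will cancel the denominator introduced by [PS_Int]. *)
Lemma Cpow_sub_le (r : R) (z w : C) (n : nat) : Cmod z <= r -> Cmod w <= r ->
  Cmod (Cpow z (S n) - Cpow w (S n))%C <= INR (S n) * r ^ n * Cmod (z - w)%C.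
Proof.
  intros Hz Hw. assert (Hr := Rle_trans _ _ _ (Cmod_ge_0 z) Hz).
  induction n as [|n IH].
  - rewrite !Cpow_1_r. simpl. lra.
  - replace (Cpow z (S (S n)) - Cpow w (S (S n)))%C
      with (z * (Cpow z (S n) - Cpow w (S n)) + Cpow w (S n) * (z - w))%C
      by (rewrite !Cpow_S; ring).
    eapply Rle_trans; [apply Cmod_triangle|].
    rewrite !Cmod_mult, Cmod_pow.
    assert (H1 : Cmod z * Cmod (Cpow z (S n) - Cpow w (S n))%C
                 <= r * (INR (S n) * r ^ n * Cmod (z - w)%C)).
    { apply Rmult_le_compat; try apply Cmod_ge_0; assumption. }
    assert (H2 : Cmod w ^ S n * Cmod (z - w)%C <= r ^ S n * Cmod (z - w)%C).
    { apply Rmult_le_compat_r; [apply Cmod_ge_0|].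
      apply pow_incr. split; [apply Cmod_ge_0|exact Hw]. }
    rewrite (S_INR (S n)). simpl pow in *. nra.
Qed.

(** [PS_Int e] begins with 0 and 1, so removing two terms subtracts [z]; the indexing is that of
    [class_J]. *)
Lemma CPS_Int_tail (e : nat -> R) (z : C) : entire e -> e 0%nat = 1 ->
  is_Cseries (fun n => (RtoC (PS_Int e (S (S n))) * Cpow z (S (S n)))%C)
    (CPS (PS_Int e) z - z)%C.
Proof.
  intros He H0.
  assert (HI := entire_Int e He).
  rewrite CPS_decr_1, (CPS_decr_1 (PS_decr_1 (PS_Int e)))
    by auto using entire_decr_1.
  set (c := PS_decr_1 (PS_decr_1 (PS_Int e))).
  assert (Hc : entire c) by now apply entire_decr_1, entire_decr_1.
  replace (PS_Int e 0%nat) with 0 by reflexivity.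
  replace (PS_decr_1 (PS_Int e) 0%nat) with 1
    by (unfold PS_decr_1, PS_Int; rewrite H0; simpl; field).
  replace (RtoC 0 + z * (RtoC 1 + z * CPS c z) - z)%C with (z * z * CPS c z)%C by ring.
  eapply is_series_ext;
    [|exact (is_series_scal (V := C_NormedModule) (z * z)%C _ _ (CPS_is_series c z Hc))].
  intros n. rewrite !Cpow_S.
  change ((z * z * (RtoC (c n) * Cpow z n))%C
          = (RtoC (c n) * (z * (z * Cpow z n)))%C). ring.
Qed.

(** With [r] the larger modulus, the tails of [f] after [z] differ by at most
    [(1 - e(r)) * |z - w|]. If [f z = f w], that difference is [- (z - w)], and [e(r) > 0] forces
    [z = w]. *)
Lemma univalent_CPS_Int (e : nat -> R) :
  entire e -> e 0%nat = 1 -> (forall n, e (S n) < 0) ->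
  (forall r, 0 <= r < 1 -> 0 < PSeries e r) ->
  univalent_on_disk (CPS (PS_Int e)).
Proof.
  intros He H0 Hneg Hpos z w Hz Hw Hzw.
  set (r := Rmax (Cmod z) (Cmod w)).
  assert (Hr : 0 <= r < 1).
  { split; [|now apply Rmax_lub_lt].
    eapply Rle_trans; [apply (Cmod_ge_0 z)|apply Rmax_l]. }
  assert (Hs := is_series_minus _ _ _ _ (CPS_Int_tail e z He H0) (CPS_Int_tail e w He H0)).
  assert (Hc := entire_decr_1 _ He).
  assert (Hv := is_series_scal_r (r * Cmod (z - w)%C) _ _
    (entire_is_series _ r (entire_scal (-1) _ Hc))).
  assert (Hle := Cmod_Cseries_le _ _ _ _ Hs Hv).
  match type of Hle with _ -> Cmod ?x <= _ => replace x with (- (z - w))%C in Hle end.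
  2:{ unfold plus, opp; simpl. rewrite Hzw.
      match goal with |- ?x = ?y => change (@eq C x y) end. ring. }
  rewrite Cmod_opp, PSeries_scal in Hle.
  assert (E := PSeries_decr_1 e r (entire_ex e r He)). rewrite H0 in E.
  specialize (Hpos r Hr).
  assert (Hd : Cmod (z - w)%C <= 0).
  { enough (Cmod (z - w)%C <= (1 - PSeries e r) * Cmod (z - w)%C)
      by (generalize (Cmod_ge_0 (z - w)%C); nra).
    rewrite E. eapply Rle_trans; [apply Hle|right; ring].
    intros n.
    match goal with |- Cmod ?x <= _ =>
      replace x with (RtoC (PS_Int e (S (S n))) * (Cpow z (S (S n)) - Cpow w (S (S n))))%C end.
    2:{ unfold plus, opp; simpl.
        match goal with |- ?x = ?y => change (@eq C x y) end. ring. }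
    rewrite Cmod_mult, Cmod_R.
    assert (Hp := Cpow_sub_le r z w (S n) (Rmax_l _ _) (Rmax_r _ _)).
    apply (Rmult_le_compat_l (Rabs (PS_Int e (S (S n))))) in Hp; [|apply Rabs_pos].
    eapply Rle_trans; [exact Hp|]. right.
    assert (HN : 0 < INR (S (S n))) by (apply lt_0_INR; lia).
    unfold PS_Int, PS_scal, PS_decr_1, scal; cbn -[INR pow]; unfold mult; cbn -[INR pow].
    rewrite Rabs_left by (apply Rdiv_neg_pos; [apply Hneg|exact HN]).
    simpl pow. field. lra. }
  apply Ceq_minus, Cmod_eq_0. generalize (Cmod_ge_0 (z - w)%C). lra.
Qed.

Lemma class_A_CPS_Int (e : nat -> R) :
  entire e -> e 0%nat = 1 -> (forall n, e (S n) < 0) ->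
  (forall r, 0 <= r < 1 -> 0 < PSeries e r) ->
  class_A (CPS (PS_Int e)).
Proof.
  intros He H0 Hneg Hpos. assert (HI := entire_Int e He).
  repeat split.
  - intros z _. eexists. now apply CPS_derive.
  - now apply univalent_CPS_Int.
  - now rewrite CPS_0.
  - rewrite C_derive_CPS, PS_derive_Int, CPS_0 by assumption. now rewrite H0.
Qed.

Lemma class_J_CPS_Int (e : nat -> R) :
  entire e -> e 0%nat = 1 -> (forall n, e (S n) < 0) -> class_J (CPS (PS_Int e)).
Proof.
  intros He H0 Hneg. split.
  - intros z _. eexists. now apply CPS_derive, entire_Int.
  - exists (fun n => - PS_Int e n). split.
    + intros [|[|n]] Hn; try lia. unfold PS_Int.
      assert (H : e (S n) / INR (S (S n)) < 0).
      { apply Rdiv_neg_pos; [apply Hneg|apply lt_0_INR; lia]. }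
      lra.
    + intros z _. exists (- (CPS (PS_Int e) z - z))%C. split; [|ring].
      eapply is_series_ext; [|exact (is_series_opp _ _ (CPS_Int_tail e z He H0))].
      intros n. rewrite Nat.add_comm, RtoC_opp. unfold opp; cbn -[PS_Int Cpow].
      match goal with |- ?x = ?y => change (@eq C x y) end.
      change (2 + n)%nat with (S (S n)). ring.
Qed.

Lemma L_den_CPS_Int (lambda : R) (e : nat -> R) (z : C) : entire e ->
  L_den lambda (CPS (PS_Int e)) z = (z * CPS (affmul lambda 1 e) z)%C.
Proof.
  intros He. assert (HI := entire_Int e He). unfold L_den.
  rewrite !(fun n => proj1 (C_Derive_n_CPS _ n HI)).
  cbn [Nat.iter nat_rect]. rewrite PS_derive_Int, CPS_affine by exact He.
  simpl Cpow. ring.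
Qed.

Lemma L_num_CPS_Int (lambda : R) (e : nat -> R) (z : C) : entire e ->
  L_num lambda (CPS (PS_Int e)) z = (z * CPS (affmul 1 1 (affmul lambda 1 e)) z)%C.
Proof.
  intros He. assert (HI := entire_Int e He). unfold L_num.
  rewrite !(fun n => proj1 (C_Derive_n_CPS _ n HI)).
  cbn [Nat.iter nat_rect].
  rewrite PS_derive_Int, CPS_affine by now apply entire_affine.
  (* Differentiation shifts the index by one, so [lambda * (n + 1) + 1] is read as
     [lambda * n + (lambda + 1)]. *)
  rewrite (CPS_ext (PS_derive (affmul lambda 1 e)) (affmul lambda (lambda + 1) (PS_derive e))).
  - rewrite !CPS_affine by auto using entire_derive.
    rewrite !RtoC_plus, RtoC_mult. simpl Cpow. ring.
  - intros n. unfold PS_derive, affmul. rewrite S_INR. ring.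
Qed.

Lemma class_Lstar_CPS_Int (lambda alpha : R) (e : nat -> R) :
  entire e -> e 0%nat = 1 -> (forall n, e (S n) < 0) ->
  0 <= alpha < 1 -> 0 <= lambda ->
  class_Lstar lambda alpha (CPS (PS_Int e)) <->
  0 <= PSeries (affmul 1 (1 - alpha) (affmul lambda 1 e)) 1.
Proof.
  intros He H0 Hneg Hal Hla.
  set (u := affmul lambda 1 e).
  assert (Hu : entire u) by now apply entire_affine.
  assert (Hu0 : u 0%nat = 1) by (unfold u, affmul; rewrite H0; simpl; ring).
  assert (Huneg : forall n, u (S n) < 0).
  { intros n. unfold u, affmul.
    assert (0 <= lambda * INR (S n)) by (apply Rmult_le_pos; [exact Hla|apply pos_INR]).
    generalize (Hneg n). nra. }
  split.
  - intros [[_ [q [Hq [_ [Hquot Hre]]]]] _].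
    apply starlike_necessary with q; try assumption.
    intros z Hz Hnz Hz0. rewrite Hquot; [|exact Hz|].
    + rewrite L_num_CPS_Int, L_den_CPS_Int by exact He. fold u. field. now split.
    + rewrite L_den_CPS_Int by exact He. now apply Cmult_neq_0.
  - intros Hcond.
    assert (Hst := fun z => starlike_sufficient u alpha z Hu Hu0 Huneg (proj2 Hal) Hcond).
    set (q := fun z => (CPS (affmul 1 1 u) z / CPS u z)%C).
    assert (Hv : entire (affmul 1 1 u)) by now apply entire_affine.
    split; [split|now apply class_J_CPS_Int].
    + apply class_A_CPS_Int; try assumption.
      intros r Hr.
      assert (Hw : 0 < PSeries (affmul 1 (1 - alpha) u) r).
      { eapply Rle_lt_trans; [exact Hcond|].
        apply PSeries_decreasing; [now apply entire_affine|intros n|lra].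
        unfold affmul at 1. rewrite S_INR. generalize (Huneg n) (pos_INR n). nra. }
      (* Univalence needs [e(r) > 0]. For [m >= 1] the weight [(m + 1 - alpha) * (lambda * m + 1)]
         is at least [1 - alpha] and [e m < 0]; at 0 the coefficients agree. *)
      assert (Hle : PSeries (affmul 1 (1 - alpha) u) r <= (1 - alpha) * PSeries e r).
      { rewrite <- PSeries_scal.
        apply PSeries_le; [now apply entire_affine|now apply entire_scal|lra|].
        intros [|n]; unfold PS_scal, scal; simpl; unfold mult; simpl; unfold u, affmul.
        - rewrite H0. simpl. lra.
        - assert (Hn := pos_INR n). rewrite S_INR.
          assert (Hl : 0 <= lambda * (INR n + 1)) by (apply Rmult_le_pos; lra).
          set (m := INR n + 1) in *.
          assert (1 - alpha <= (1 * m + (1 - alpha)) * (lambda * m + 1)) by (unfold m in *; nra).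
          generalize (Hneg n). nra. }
      nra.
    + exists q. repeat split.
      * intros z Hz. apply ex_Cderive_div.
        -- eexists. now apply CPS_derive.
        -- eexists. now apply CPS_derive.
        -- exact (proj1 (Hst z Hz)).
      * unfold q. rewrite !CPS_0 by assumption.
        unfold affmul at 1. rewrite Hu0. simpl INR.
        replace ((1 * 0 + 1) * 1) with 1 by ring. field.
      * intros z Hz Hnz. rewrite L_den_CPS_Int in * by exact He.
        rewrite L_num_CPS_Int by exact He. fold u in Hnz |- *. unfold q. field.
        split; [exact (proj1 (Hst z Hz))|]. intros ->. apply Hnz. ring.
      * intros z Hz. exact (proj2 (Hst z Hz)).
Qed.

(** * The Gamma function *)

Definition continuous_pos (f : R -> R) : Prop := forall t, 0 < t -> continuous f t.

(** The limit behind [RInt_gen] at 0 and at infinity, unfolded so that it can be handled by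
    inequalities between reals. *)
Definition improper (f : R -> R) (l : R) : Prop :=
  forall eps, 0 < eps -> exists d N, 0 < d /\
    forall a b, 0 < a < d -> N < b -> a < b -> Rabs (RInt f a b - l) < eps.

Lemma ex_RInt_pos (f : R -> R) (a b : R) : continuous_pos f -> 0 < a -> a <= b -> ex_RInt f a b.
Proof.
  intros Hf Ha Hab. apply (ex_RInt_continuous (V := R_CompleteNormedModule)).
  intros t. rewrite Rmin_left, Rmax_right by exact Hab. intros Ht. apply Hf. lra.
Qed.

Lemma improper_is_RInt_gen (f : R -> R) (l : R) : continuous_pos f -> improper f l ->
  is_RInt_gen f (at_right 0) (Rbar_locally p_infty) l.
Proof.
  intros Hf Hl P [eps HP].
  destruct (Hl eps (cond_pos eps)) as [d [N [Hd H]]].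
  (* The bounds by 1 ensure [a < 1 < b]. *)
  apply Filter_prod with (fun a => 0 < a < Rmin d 1) (fun b => Rmax N 1 < b).
  - assert (Hm : 0 < Rmin d 1) by (apply Rmin_pos; lra).
    exists (mkposreal _ Hm). intros a Ha Ha0.
    apply Rabs_def2 in Ha. unfold minus, plus, opp in Ha; simpl in Ha. lra.
  - exists (Rmax N 1). auto.
  - intros a b Ha Hb. simpl.
    assert (H1 := Rmin_l d 1). assert (H2 := Rmin_r d 1).
    assert (H3 := Rmax_l N 1). assert (H4 := Rmax_r N 1).
    exists (RInt f a b). split.
    + apply (RInt_correct (V := R_CompleteNormedModule)), ex_RInt_pos; [exact Hf|lra|lra].
    + apply HP. apply H; lra.
Qed.

Lemma RInt_subset_le (f : R -> R) (a b c d : R) : continuous_pos f ->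
  (forall t, 0 < t -> 0 <= f t) -> 0 < a -> a <= b -> b <= c -> c <= d ->
  RInt f b c <= RInt f a d.
Proof.
  intros Hf Hpos Ha Hab Hbc Hcd.
  rewrite <- (RInt_Chasles f a b d) by (apply ex_RInt_pos; auto; lra).
  rewrite <- (RInt_Chasles f b c d) by (apply ex_RInt_pos; auto; lra).
  assert (H1 : 0 <= RInt f a b).
  { apply RInt_ge_0; [lra|apply ex_RInt_pos; auto; lra|]. intros x Hx. apply Hpos. lra. }
  assert (H2 : 0 <= RInt f c d).
  { apply RInt_ge_0; [lra|apply ex_RInt_pos; auto; lra|]. intros x Hx. apply Hpos. lra. }
  unfold plus; simpl. lra.
Qed.

(** For nonnegative [f] the limit is the supremum of the integrals over compact intervals. The bound
    by [RInt f 1 2] later yields positivity of Gamma. *)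
Lemma improper_bounded (f : R -> R) (M : R) : continuous_pos f ->
  (forall t, 0 < t -> 0 <= f t) ->
  (forall a b, 0 < a -> a <= b -> RInt f a b <= M) ->
  exists l, improper f l /\ RInt f 1 2 <= l.
Proof.
  intros Hf Hpos HM.
  destruct (completeness (fun y => exists a b, 0 < a /\ a <= b /\ y = RInt f a b)) as [l [Hub Hl]].
  - exists M. intros y [a [b [Ha [Hab ->]]]]. now apply HM.
  - exists (RInt f 1 2), 1, 2. repeat split; lra.
  - exists l. split.
    + intros eps Heps.
      assert (H : exists a b, 0 < a /\ a <= b /\ l - eps < RInt f a b).
      { apply Classical_Prop.NNPP. intros Hn.
        assert (l <= l - eps); [|lra]. apply Hl. intros y [a [b [Ha [Hab ->]]]].
        apply Rnot_lt_le. intros Hlt. apply Hn. now exists a, b. }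
      destruct H as [a0 [b0 [Ha0 [Hab0 H]]]].
      exists a0, b0. split; [exact Ha0|]. intros a b Ha Hb Hab.
      assert (H1 : RInt f a b <= l).
      { apply Hub. exists a, b. repeat split; lra. }
      assert (H2 : RInt f a0 b0 <= RInt f a b) by (apply RInt_subset_le; auto; lra).
      apply Rabs_def1; lra.
    + apply Hub. exists 1, 2. repeat split; lra.
Qed.

Definition gamma_kernel (x t : R) : R := Rpower t (x - 1) * exp (- t).

(** The boundary term of the integration by parts that relates the kernels for [x] and [x + 1]. *)
Definition gamma_boundary (x t : R) : R := Rpower t x * exp (- t).

Lemma is_derive_Rpower (x t : R) : 0 < t ->
  is_derive (fun s => Rpower s x) t (x * Rpower t (x - 1)).
Proof. intros Ht. apply is_derive_Reals. now apply derivable_pt_lim_power. Qed.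

Lemma continuous_gamma_kernel (x : R) : continuous_pos (gamma_kernel x).
Proof.
  intros t Ht. apply (ex_derive_continuous (V := R_NormedModule)). eexists.
  apply (is_derive_mult (K := R_AbsRing) (fun s => Rpower s (x - 1)) (fun s => exp (- s))).
  - now apply is_derive_Rpower.
  - auto_derive; auto.
  - exact Rmult_comm.
Qed.

Lemma is_derive_gamma_boundary (x t : R) : 0 < t ->
  is_derive (gamma_boundary x) t (x * gamma_kernel x t - gamma_kernel (x + 1) t).
Proof.
  intros Ht.
  replace (x * gamma_kernel x t - gamma_kernel (x + 1) t)
    with (plus (mult (x * Rpower t (x - 1)) (exp (- t))) (mult (Rpower t x) (- exp (- t)))).
  - apply (is_derive_mult (K := R_AbsRing) (fun s => Rpower s x) (fun s => exp (- s))).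
    + now apply is_derive_Rpower.
    + auto_derive; auto. ring.
    + exact Rmult_comm.
  - unfold gamma_kernel, plus, mult; simpl. replace (x + 1 - 1) with x by ring. ring.
Qed.

Lemma RInt_gamma_kernel_succ (x a b : R) : 0 < a -> a <= b ->
  RInt (gamma_kernel (x + 1)) a b
  = x * RInt (gamma_kernel x) a b - (gamma_boundary x b - gamma_boundary x a).
Proof.
  intros Ha Hab.
  assert (H : is_RInt (fun t => x * gamma_kernel x t - gamma_kernel (x + 1) t) a b
                (gamma_boundary x b - gamma_boundary x a)).
  { apply (is_RInt_derive (V := R_CompleteNormedModule) (gamma_boundary x)).
    - intros t. rewrite Rmin_left by exact Hab. intros Ht.
      apply is_derive_gamma_boundary. lra.
    - intros t. rewrite Rmin_left by exact Hab. intros Ht.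
      apply (continuous_minus (V := R_NormedModule));
        [apply (continuous_scal_r (V := R_NormedModule))|];
        apply continuous_gamma_kernel; lra. }
  assert (H1 := RInt_correct (V := R_CompleteNormedModule) _ _ _
    (ex_RInt_pos _ a b (continuous_gamma_kernel x) Ha Hab)).
  assert (H2 := RInt_correct (V := R_CompleteNormedModule) _ _ _
    (ex_RInt_pos _ a b (continuous_gamma_kernel (x + 1)) Ha Hab)).
  assert (H3 := is_RInt_minus _ _ _ _ _ _ (is_RInt_scal _ _ _ x _ H1) H2).
  assert (E := is_RInt_unique _ _ _ _ H3).
  rewrite <- (is_RInt_unique _ _ _ _ H).
  change (RInt (fun t => x * gamma_kernel x t - gamma_kernel (x + 1) t) a b
     = x * RInt (gamma_kernel x) a b - RInt (gamma_kernel (x + 1)) a b) in E.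
  lra.
Qed.

(* [x * ln (t / (2 * x)) <= t / 2], so [t ^ x] is dominated by [exp (t / 2)]. *)
Lemma gamma_boundary_le (x t : R) : 0 < x -> 0 < t ->
  0 < gamma_boundary x t <= Rpower (2 * x) x * exp (- (t / 2)).
Proof.
  intros Hx Ht. unfold gamma_boundary, Rpower.
  rewrite <- !exp_plus. split; [apply exp_pos|].
  assert (Hl : ln t - ln (2 * x) <= t / (2 * x)).
  { rewrite <- ln_div by lra.
    assert (Hp : 0 < t / (2 * x)) by (apply Rdiv_lt_0_compat; lra).
    assert (H := exp_ineq1_le (ln (t / (2 * x)))).
    rewrite exp_ln in H by exact Hp. lra. }
  apply (Rmult_le_compat_l x) in Hl; [|lra].
  replace (x * (t / (2 * x))) with (t / 2) in Hl by (field; lra).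
  assert (H : x * ln t + - t <= x * ln (2 * x) + - (t / 2)) by lra.
  destruct H as [H|H]; [left; now apply exp_increasing|right; now rewrite H].
Qed.

Lemma gamma_kernel_pos (x t : R) : 0 < gamma_kernel x t.
Proof. apply Rmult_lt_0_compat; apply exp_pos. Qed.

Lemma gamma_kernel_succ (x t : R) : gamma_kernel (x + 1) t = gamma_boundary x t.
Proof.
  unfold gamma_kernel, gamma_boundary. now replace (x + 1 - 1) with x by ring.
Qed.

(** For [x < 1] the kernel is singular at 0, so the estimate goes through [x + 1]: integration by
    parts gives [x] times the integral as an integral of at most [2 * C] plus a boundary term of at
    most [C]. *)
Lemma RInt_gamma_kernel_le (x a b : R) : 0 < x -> 0 < a -> a <= b ->
  RInt (gamma_kernel x) a b <= 3 * Rpower (2 * x) x / x.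
Proof.
  intros Hx Ha Hab. set (C := Rpower (2 * x) x).
  assert (HC : 0 < C) by apply exp_pos.
  assert (HI : is_RInt (fun t => C * exp (- (t / 2))) a b
     (- 2 * C * exp (- (b / 2)) - - 2 * C * exp (- (a / 2)))).
  { apply (is_RInt_derive (V := R_CompleteNormedModule) (fun t => - 2 * C * exp (- (t / 2)))).
    - intros t _. auto_derive; [exact I|]. unfold Rdiv. field.
    - intros t _. apply (ex_derive_continuous (V := R_NormedModule)). auto_derive; auto. }
  assert (H1 : RInt (gamma_kernel (x + 1)) a b
               <= - 2 * C * exp (- (b / 2)) - - 2 * C * exp (- (a / 2))).
  { rewrite <- (is_RInt_unique _ _ _ _ HI).
    apply RInt_le; [exact Hab|apply ex_RInt_pos; auto using continuous_gamma_kernel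
      |eexists; exact HI|].
    intros t Ht. rewrite gamma_kernel_succ. apply gamma_boundary_le; lra. }
  rewrite RInt_gamma_kernel_succ in H1 by assumption.
  assert (H2 := gamma_boundary_le x b Hx ltac:(lra)).
  assert (H3 := gamma_boundary_le x a Hx Ha). fold C in H2, H3.
  assert (Hea : exp (- (a / 2)) <= 1).
  { rewrite <- exp_0. left. apply exp_increasing. lra. }
  assert (Heb := exp_pos (- (b / 2))).
  apply Rmult_le_reg_r with x; [exact Hx|].
  unfold Rdiv. rewrite Rmult_assoc, Rinv_l, Rmult_1_r by lra.
  apply (Rmult_le_compat_l C) in Hea; [|lra].
  apply (Rmult_lt_compat_l C) in Heb; [|lra].
  lra.
Qed.

Lemma Gamma_improper (x : R) : 0 < x -> improper (gamma_kernel x) (Gamma x) /\ 0 < Gamma x.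
Proof.
  intros Hx.
  destruct (improper_bounded (gamma_kernel x) (3 * Rpower (2 * x) x / x)) as [l [Hl H12]].
  - apply continuous_gamma_kernel.
  - intros t _. apply Rlt_le, gamma_kernel_pos.
  - intros a b Ha Hab. now apply RInt_gamma_kernel_le.
  - replace (Gamma x) with l.
    + split; [exact Hl|]. eapply Rlt_le_trans; [|exact H12].
      apply RInt_gt_0; [lra|intros; apply gamma_kernel_pos|].
      intros t Ht. apply continuous_gamma_kernel. lra.
    + symmetry.
      change (RInt_gen (gamma_kernel x) (at_right 0) (Rbar_locally p_infty) = l).
      apply (is_RInt_gen_unique (V := R_CompleteNormedModule)).
      apply improper_is_RInt_gen; [apply continuous_gamma_kernel|exact Hl].
Qed.

Lemma improper_unique (f : R -> R) (l l' : R) : improper f l -> improper f l' -> l = l'.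
Proof.
  intros Hl Hl'. apply cond_eq. intros eps Heps.
  destruct (Hl (eps / 2)) as [d [N [Hd H]]]; [lra|].
  destruct (Hl' (eps / 2)) as [d' [N' [Hd' H']]]; [lra|].
  set (a := Rmin (d / 2) (d' / 2)). set (b := Rmax (a + 1) (Rmax (N + 1) (N' + 1))).
  assert (Ha : 0 < a) by (apply Rmin_pos; lra).
  assert (Ha1 : a <= d / 2) by apply Rmin_l. assert (Ha2 : a <= d' / 2) by apply Rmin_r.
  assert (Hb : a + 1 <= b) by apply Rmax_l.
  assert (Hb1 : N + 1 <= b) by (eapply Rle_trans; [apply Rmax_l|apply Rmax_r]).
  assert (Hb2 : N' + 1 <= b) by (eapply Rle_trans; [apply Rmax_r|apply Rmax_r]).
  specialize (H a b ltac:(lra) ltac:(lra) ltac:(lra)).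
  specialize (H' a b ltac:(lra) ltac:(lra) ltac:(lra)).
  apply Rabs_def2 in H. apply Rabs_def2 in H'. apply Rabs_def1; lra.
Qed.

Lemma gamma_boundary_small_0 (x eps : R) : 0 < x -> 0 < eps ->
  exists d, 0 < d /\ forall t, 0 < t < d -> gamma_boundary x t < eps.
Proof.
  (* The solution of [t ^ x = eps]; the exponential factor is below 1. *)
  intros Hx He. exists (Rpower eps (/ x)). split; [apply exp_pos|].
  intros t Ht. unfold gamma_boundary.
  assert (H : Rpower t x < eps).
  { rewrite <- (Rpower_1 eps) by exact He. rewrite <- (Rinv_l x) by lra.
    rewrite <- Rpower_mult. now apply Rlt_Rpower_l. }
  assert (He1 : exp (- t) < 1) by (rewrite <- exp_0; apply exp_increasing; lra).
  assert (Hp : 0 < Rpower t x) by apply exp_pos.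
  assert (He0 := exp_pos (- t)). nra.
Qed.

Lemma gamma_boundary_small_infty (x eps : R) : 0 < x -> 0 < eps ->
  exists N, 0 < N /\ forall t, N < t -> gamma_boundary x t < eps.
Proof.
  intros Hx He. set (C := Rpower (2 * x) x). assert (HC : 0 < C) by apply exp_pos.
  (* Chosen so that [C < eps * (t / 2)], which suffices since [exp (t / 2) >= 1 + t / 2]. *)
  exists (2 * (C / eps)).
  assert (HN : 0 < C / eps) by now apply Rdiv_lt_0_compat.
  split; [lra|]. intros t Ht.
  eapply Rle_lt_trans; [apply gamma_boundary_le; [exact Hx|lra]|]. fold C.
  rewrite exp_Ropp. assert (H := exp_ineq1_le (t / 2)).
  apply Rmult_lt_reg_r with (exp (t / 2)); [apply exp_pos|].
  rewrite Rmult_assoc, Rinv_l, Rmult_1_r by (apply Rgt_not_eq, exp_pos).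
  apply Rlt_le_trans with (eps * (t / 2)).
  - replace C with (eps * (C / eps)) at 1 by (field; lra).
    apply Rmult_lt_compat_l; lra.
  - apply Rmult_le_compat_l; lra.
Qed.

Lemma Gamma_succ (x : R) : 0 < x -> Gamma (x + 1) = x * Gamma x.
Proof.
  intros Hx. apply (improper_unique (gamma_kernel (x + 1))).
  - apply Gamma_improper. lra.
  - intros eps Heps.
    (* The integral is later multiplied by [x]. The two boundary terms are positive and below
       [eps / 2], hence so is the absolute value of their difference. *)
    destruct (proj1 (Gamma_improper x Hx) (eps / (2 * x))) as [d [N [Hd H]]].
    { apply Rdiv_lt_0_compat; lra. }
    destruct (gamma_boundary_small_0 x (eps / 2) Hx ltac:(lra)) as [d' [Hd' H0]].
    destruct (gamma_boundary_small_infty x (eps / 2) Hx ltac:(lra)) as [N' [HN' Hinf]].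
    exists (Rmin d d'), (Rmax N N'). split; [now apply Rmin_pos|].
    intros a b Ha Hb Hab.
    assert (Ha1 := Rmin_l d d'). assert (Ha2 := Rmin_r d d').
    assert (Hb1 := Rmax_l N N'). assert (Hb2 := Rmax_r N N').
    rewrite RInt_gamma_kernel_succ by lra.
    specialize (H a b ltac:(lra) ltac:(lra) Hab).
    specialize (H0 a ltac:(lra)). specialize (Hinf b ltac:(lra)).
    assert (Hpa := gamma_boundary_le x a Hx ltac:(lra)).
    assert (Hpb := gamma_boundary_le x b Hx ltac:(lra)).
    apply Rabs_def2 in H.
    assert (E : x * (eps / (2 * x)) = eps / 2) by (field; lra).
    destruct H as [H1 H2].
    apply (Rmult_lt_compat_l x) in H1, H2; try lra.
    apply Rabs_def1; lra.
Qed.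

(** * The Gaussian integral *)

Definition gauss (u : R) : R := exp (- u ^ 2).

Definition gauss_int (x : R) : R := RInt gauss 0 x.

(** The classical companion integrand: its integral over [0, 1] has, as a function of [x],
    derivative opposite to that of [gauss_int x ^ 2]. *)
Definition gauss_aux (x t : R) : R := exp (- (x ^ 2 * (1 + t ^ 2))) / (1 + t ^ 2).

Lemma one_plus_sq_pos (t : R) : 0 < 1 + t ^ 2.
Proof. generalize (pow2_ge_0 t). lra. Qed.

Lemma continuous_gauss (u : R) : continuous gauss u.
Proof. apply (ex_derive_continuous (V := R_NormedModule)). unfold gauss. auto_derive; auto. Qed.

Lemma ex_RInt_gauss (a b : R) : ex_RInt gauss a b.
Proof.
  apply (ex_RInt_continuous (V := R_CompleteNormedModule)).
  intros; apply continuous_gauss.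
Qed.

Lemma is_derive_gauss_int (x : R) : is_derive gauss_int x (gauss x).
Proof.
  apply (is_derive_RInt (V := R_NormedModule) gauss gauss_int 0 x).
  - exists (mkposreal 1 Rlt_0_1). intros y _.
    apply (RInt_correct (V := R_CompleteNormedModule)), ex_RInt_gauss.
  - apply continuous_gauss.
Qed.

Lemma is_derive_gauss_aux (x t : R) :
  is_derive (fun u => gauss_aux u t) x (- 2 * x * exp (- (x ^ 2 * (1 + t ^ 2)))).
Proof.
  assert (H := one_plus_sq_pos t). unfold gauss_aux. auto_derive; [lra|].
  replace (1 + t * (t * 1)) with (1 + t ^ 2) by ring.
  replace (x * (x * 1)) with (x ^ 2) by ring. field. lra.
Qed.

Lemma RInt_gauss_scaled (x : R) :
  RInt (fun t => - 2 * x * exp (- (x ^ 2 * (1 + t ^ 2)))) 0 1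
  = - 2 * gauss x * gauss_int x.
Proof.
  (* Prepares the substitution [u = x * t]; the [+ 0] matches the affine form of [RInt_comp_lin]. *)
  transitivity (RInt (fun t => scal (- 2 * gauss x) (scal x (gauss (x * t + 0)))) 0 1).
  - apply RInt_ext. intros t _.
    change (- 2 * x * exp (- (x ^ 2 * (1 + t ^ 2)))
            = - 2 * gauss x * (x * gauss (x * t + 0))).
    unfold gauss.
    replace (- (x ^ 2 * (1 + t ^ 2))) with (- x ^ 2 + - (x * t + 0) ^ 2) by ring.
    rewrite exp_plus. ring.
  - rewrite (RInt_scal (V := R_CompleteNormedModule)).
    + rewrite (RInt_comp_lin (V := R_CompleteNormedModule)) by apply ex_RInt_gauss.
      unfold gauss_int. replace (x * 0 + 0) with 0 by ring.
      now replace (x * 1 + 0) with x by ring.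
    + apply (ex_RInt_comp_lin (V := R_NormedModule)), ex_RInt_gauss.
Qed.

Lemma ex_RInt_gauss_aux (x : R) : ex_RInt (gauss_aux x) 0 1.
Proof.
  apply (ex_RInt_continuous (V := R_CompleteNormedModule)). intros t _.
  apply (ex_derive_continuous (V := R_NormedModule)). unfold gauss_aux.
  auto_derive. generalize (one_plus_sq_pos t). simpl. lra.
Qed.

Lemma is_derive_RInt_gauss_aux (x : R) :
  is_derive (fun y => RInt (gauss_aux y) 0 1) x (- 2 * gauss x * gauss_int x).
Proof.
  rewrite <- RInt_gauss_scaled.
  rewrite (RInt_ext _ (fun t => Derive (fun u => gauss_aux u t) x)).
  2:{ intros t _. symmetry. apply is_derive_unique, is_derive_gauss_aux. }
  apply (is_derive_RInt_param gauss_aux 0 1 x).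
  - exists (mkposreal 1 Rlt_0_1). intros y _ t _. eexists. apply is_derive_gauss_aux.
  - intros t _.
    apply (continuity_2d_pt_ext (fun u v => - 2 * u * exp (- (u ^ 2 * (1 + v ^ 2))))).
    { intros u v. symmetry. apply is_derive_unique, is_derive_gauss_aux. }
    apply continuity_2d_pt_mult.
    + apply continuity_2d_pt_mult; [apply continuity_2d_pt_const|apply continuity_2d_pt_id1].
    + apply (continuity_1d_2d_pt_comp exp).
      { apply derivable_continuous_pt, derivable_pt_exp. }
      apply continuity_2d_pt_opp, continuity_2d_pt_mult.
      * apply (continuity_1d_2d_pt_comp (fun u => u ^ 2)); [|apply continuity_2d_pt_id1].
        apply derivable_continuous_pt, derivable_pt_pow.
      * apply continuity_2d_pt_plus; [apply continuity_2d_pt_const|].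
        apply (continuity_1d_2d_pt_comp (fun u => u ^ 2)); [|apply continuity_2d_pt_id2].
        apply derivable_continuous_pt, derivable_pt_pow.
  - exists (mkposreal 1 Rlt_0_1). intros y _. apply ex_RInt_gauss_aux.
Qed.

(* The left-hand side has derivative [0]; at [x = 0] it is [atan 1]. *)
Lemma gauss_int_sqr (x : R) : 0 < x ->
  gauss_int x ^ 2 + RInt (gauss_aux x) 0 1 = PI / 4.
Proof.
  intros Hx.
  rewrite <- (eq_is_derive (V := R_NormedModule)
    (fun y => gauss_int y ^ 2 + RInt (gauss_aux y) 0 1) 0 x); [| |exact Hx].
  - unfold gauss_int at 1. rewrite RInt_point.
    rewrite (RInt_ext _ (fun t => / (1 + Rsqr t))).
    + rewrite (is_RInt_unique _ _ _ (minus (atan 1) (atan 0))).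
      * rewrite atan_1, atan_0. change (0 ^ 2 + (PI / 4 + - 0) = PI / 4). ring.
      * apply (is_RInt_derive (V := R_CompleteNormedModule) atan).
        -- intros t _. apply is_derive_atan.
        -- intros t _. apply (ex_derive_continuous (V := R_NormedModule)).
           unfold Rsqr. auto_derive. generalize (one_plus_sq_pos t). simpl. lra.
    + intros t _. unfold gauss_aux, Rsqr, Rdiv.
      replace (- (0 ^ 2 * (1 + t ^ 2))) with 0 by ring. rewrite exp_0.
      replace (1 + t * t) with (1 + t ^ 2) by ring. apply Rmult_1_l.
  - intros t _.
    replace (zero (G := R_NormedModule))
      with (plus (2 * gauss t * gauss_int t) (- 2 * gauss t * gauss_int t))
      by (change (2 * gauss t * gauss_int t + - 2 * gauss t * gauss_int t = 0); ring).
    apply (is_derive_plus (V := R_NormedModule) (fun y => gauss_int y ^ 2)).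
    + replace (2 * gauss t * gauss_int t) with (INR 2 * gauss t * gauss_int t ^ pred 2)
        by (simpl; ring).
      apply is_derive_pow, is_derive_gauss_int.
    + apply is_derive_RInt_gauss_aux.
Qed.

Lemma RInt_gauss_aux_le (x : R) : 0 <= RInt (gauss_aux x) 0 1 <= / (1 + x ^ 2).
Proof.
  assert (Hx := one_plus_sq_pos x).
  split.
  - apply RInt_ge_0; [lra|apply ex_RInt_gauss_aux|]. intros t _.
    apply Rlt_le, Rdiv_lt_0_compat; [apply exp_pos|apply one_plus_sq_pos].
  - replace (/ (1 + x ^ 2)) with (RInt (fun _ => / (1 + x ^ 2)) 0 1).
    2:{ rewrite RInt_const. unfold scal; simpl; unfold mult; simpl. ring. }
    apply RInt_le; [lra|apply ex_RInt_gauss_aux|apply ex_RInt_const|].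
    intros t _. assert (Ht := one_plus_sq_pos t). unfold gauss_aux.
    assert (H1 : 0 < exp (- (x ^ 2 * (1 + t ^ 2))) <= / (1 + x ^ 2)).
    { split; [apply exp_pos|]. rewrite exp_Ropp. apply Rinv_le_contravar; [exact Hx|].
      assert (H := exp_ineq1_le (x ^ 2 * (1 + t ^ 2))).
      assert (0 <= x ^ 2 * t ^ 2) by (apply Rmult_le_pos; apply pow2_ge_0). lra. }
    apply Rle_trans with (exp (- (x ^ 2 * (1 + t ^ 2))) * 1); [|lra].
    apply Rmult_le_compat_l; [lra|].
    rewrite <- Rinv_1. apply Rinv_le_contravar; [lra|]. generalize (pow2_ge_0 t). lra.
Qed.

Lemma gauss_int_bounds (x : R) : 0 <= x -> 0 <= gauss_int x <= x.
Proof.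
  intros Hx. split.
  - apply RInt_ge_0; [exact Hx|apply ex_RInt_gauss|]. intros t _. apply Rlt_le, exp_pos.
  - replace x with (RInt (fun _ => 1) 0 x) at 2
      by (rewrite RInt_const; unfold scal; simpl; unfold mult; simpl; ring).
    apply RInt_le; [exact Hx|apply ex_RInt_gauss|apply ex_RInt_const|].
    intros t _. unfold gauss. rewrite <- exp_0.
    assert (H := pow2_ge_0 t).
    destruct (Req_dec (t ^ 2) 0) as [->|E]; [rewrite Ropp_0; lra|].
    left. apply exp_increasing. lra.
Qed.

(** From [h^2 + k = s^2 / 4] follows [h - s / 2 = - k / (h + s / 2)], and [h >= 0]. The explicit
    rate provides the threshold in [Gamma_half]. *)
Lemma gauss_int_limit (x : R) : 0 < x ->
  Rabs (gauss_int x - sqrt PI / 2) <= 2 / sqrt PI * / (1 + x ^ 2).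
Proof.
  intros Hx. set (s := sqrt PI).
  assert (Hs : 0 < s) by (apply sqrt_lt_R0, PI_RGT_0).
  assert (Hs2 : s * s = PI) by (apply sqrt_sqrt; generalize PI_RGT_0; lra).
  assert (H1 := gauss_int_sqr x Hx). assert (H2 := RInt_gauss_aux_le x).
  assert (H3 := proj1 (gauss_int_bounds x (Rlt_le _ _ Hx))).
  set (h := gauss_int x) in *. set (k := RInt (gauss_aux x) 0 1) in *.
  assert (E : h - s / 2 = - (k / (h + s / 2))).
  { replace k with (s * s / 4 - h ^ 2) by lra. field. lra. }
  rewrite E, Rabs_Ropp, Rabs_pos_eq.
  - unfold Rdiv. rewrite Rmult_comm. apply Rmult_le_compat; try lra.
    + apply Rlt_le, Rinv_0_lt_compat. lra.
    + replace (2 * / s) with (/ (s / 2)) by (field; lra).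
      apply Rinv_le_contravar; lra.
  - apply Rmult_le_pos; [lra|]. apply Rlt_le, Rinv_0_lt_compat. lra.
Qed.

Lemma RInt_gamma_kernel_half (a b : R) : 0 < a -> a <= b ->
  RInt (gamma_kernel (1 / 2)) a b = 2 * gauss_int (sqrt b) - 2 * gauss_int (sqrt a).
Proof.
  intros Ha Hab.
  apply is_RInt_unique.
  apply (is_RInt_derive (V := R_CompleteNormedModule) (fun t => 2 * gauss_int (sqrt t))).
  - intros t. rewrite Rmin_left by exact Hab. intros Ht.
    assert (Ht0 : 0 < t) by lra. assert (Hst := sqrt_lt_R0 t Ht0).
    replace (gamma_kernel (1 / 2) t) with (scal 2 (scal (/ (2 * sqrt t)) (gauss (sqrt t)))).
    + apply (is_derive_scal (fun t => gauss_int (sqrt t))).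
      apply (is_derive_comp (V := R_NormedModule) gauss_int sqrt).
      * apply is_derive_gauss_int.
      * apply is_derive_Reals. now apply derivable_pt_lim_sqrt.
    + unfold gamma_kernel, gauss, scal; simpl; unfold mult; simpl.
      replace (1 / 2 - 1) with (- / 2) by field.
      rewrite Rpower_Ropp, Rpower_sqrt by exact Ht0.
      rewrite Rmult_1_r, sqrt_sqrt by lra. field. lra.
  - intros t. rewrite Rmin_left by exact Hab. intros Ht.
    apply continuous_gamma_kernel. lra.
Qed.

Lemma Gamma_half : Gamma (1 / 2) = sqrt PI.
Proof.
  apply (improper_unique (gamma_kernel (1 / 2))).
  { apply Gamma_improper. lra. }
  intros eps Heps.
  assert (Hs : 0 < sqrt PI) by (apply sqrt_lt_R0, PI_RGT_0).
  set (c := 2 / sqrt PI). assert (Hc : 0 < c) by (apply Rdiv_lt_0_compat; lra).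
  (* Both ends then contribute less than [eps / 2]: [2 * sqrt a] at the lower one, [2 * c / (1 + b)]
     at the upper one. *)
  exists ((eps / 4) ^ 2), (4 * c / eps).
  split; [apply pow_lt; lra|]. intros a b Ha Hb Hab.
  rewrite RInt_gamma_kernel_half by lra.
  assert (Hb0 : 0 < b) by lra.
  assert (H1 := gauss_int_limit (sqrt b) (sqrt_lt_R0 b Hb0)). fold c in H1.
  rewrite pow2_sqrt in H1 by lra.
  assert (H2 := gauss_int_bounds (sqrt a) (sqrt_pos a)).
  assert (H3 : sqrt a < eps / 4).
  { rewrite <- (sqrt_pow2 (eps / 4)) by lra. apply sqrt_lt_1; lra. }
  assert (H4 : c * / (1 + b) < eps / 4).
  { apply Rmult_lt_reg_r with (1 + b); [lra|].
    rewrite Rmult_assoc, Rinv_l, Rmult_1_r by lra.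
    apply (Rmult_lt_compat_l (eps / 4)) in Hb; [|lra].
    replace (eps / 4 * (4 * c / eps)) with c in Hb by (field; lra). lra. }
  apply Rabs_def1; apply Rabs_le_between in H1; lra.
Qed.

(** * The Bessel-Struve kernel *)

Lemma entire_fact_bound (a : nat -> R) (M : R) :
  (forall n, Rabs (a n) <= M * / INR (fact n)) -> entire a.
Proof.
  intros H. apply entire_of_ex_series. intros x.
  apply (ex_series_le (V := R_CompleteNormedModule) _
           (fun n => M * (/ INR (fact n) * Rabs x ^ n))).
  - intros n. change (Rabs (Rabs (a n * x ^ n)) <= M * (/ INR (fact n) * Rabs x ^ n)).
    rewrite Rabs_Rabsolu, Rabs_mult, <- RPow_abs, <- Rmult_assoc.
    apply Rmult_le_compat_r; [apply pow_le, Rabs_pos|apply H].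
  - apply (ex_series_scal_l (V := R_NormedModule) M).
    exists (exp (Rabs x)).
    exact (proj1 (is_pseries_R _ _ _) (is_exp_Reals (Rabs x))).
Qed.

Definition gamma_ratio (nu : R) (n : nat) : R :=
  Gamma ((INR n + 1) / 2) / Gamma (INR n / 2 + nu + 1).

Lemma Gamma_pos (x : R) : 0 < x -> 0 < Gamma x.
Proof. apply Gamma_improper. Qed.

Lemma gamma_ratio_pos (nu : R) (n : nat) : - 1 < nu -> 0 < gamma_ratio nu n.
Proof.
  intros Hnu. assert (Hn := pos_INR n).
  apply Rdiv_lt_0_compat; apply Gamma_pos; lra.
Qed.

(** Raising [n] by 2 raises both Gamma arguments by 1, so the functional equation multiplies the
    ratio by [p / q]; [p < q] is exactly [nu > -1/2]. *)
Lemma gamma_ratio_step (nu : R) (n : nat) : - (1 / 2) < nu ->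
  gamma_ratio nu (S (S n)) <= gamma_ratio nu n.
Proof.
  intros Hnu. assert (Hn := pos_INR n).
  assert (Hr : 0 < gamma_ratio nu n) by (apply gamma_ratio_pos; lra).
  set (p := (INR n + 1) / 2). set (q := INR n / 2 + nu + 1).
  assert (Hp : 0 < p) by (unfold p; lra). assert (Hpq : p < q) by (unfold p, q; lra).
  assert (E : gamma_ratio nu (S (S n)) = p / q * gamma_ratio nu n).
  { unfold gamma_ratio. rewrite !S_INR.
    replace ((INR n + 1 + 1 + 1) / 2) with (p + 1) by (unfold p; field).
    replace ((INR n + 1 + 1) / 2 + nu + 1) with (q + 1) by (unfold q; field).
    fold p q. rewrite !Gamma_succ by lra.
    assert (Hq := Gamma_pos q ltac:(lra)). field. lra. }
  assert (H1 : p / q < 1).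
  { apply Rmult_lt_reg_r with q; [lra|]. unfold Rdiv.
    rewrite Rmult_assoc, Rinv_l by lra. lra. }
  rewrite E. nra.
Qed.

Lemma gamma_ratio_bound (nu : R) (n : nat) : - (1 / 2) < nu ->
  gamma_ratio nu n <= gamma_ratio nu 0 + gamma_ratio nu 1.
Proof.
  intros Hnu.
  assert (H0 := gamma_ratio_pos nu 0 ltac:(lra)).
  assert (H1 := gamma_ratio_pos nu 1 ltac:(lra)).
  (* The recursion has step 2, so consecutive indices are carried together; the sum bounds the seeds
     of both parities. *)
  enough (gamma_ratio nu n <= gamma_ratio nu 0 + gamma_ratio nu 1 /\
          gamma_ratio nu (S n) <= gamma_ratio nu 0 + gamma_ratio nu 1) by tauto.
  induction n as [|n [IH1 IH2]]; [split; lra|].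
  split; [exact IH2|]. generalize (gamma_ratio_step nu n Hnu). lra.
Qed.

Lemma bessel_struve_coeff_ratio (nu : R) (n : nat) : - 1 < nu ->
  bessel_struve_coeff nu n
  = Gamma (nu + 1) / sqrt PI * gamma_ratio nu n * / INR (fact n).
Proof.
  intros Hnu. unfold bessel_struve_coeff, gamma_ratio.
  assert (Hs := sqrt_lt_R0 PI PI_RGT_0). assert (Hf := INR_fact_lt_0 n).
  assert (Hn := pos_INR n).
  assert (Hg := Gamma_pos (INR n / 2 + nu + 1) ltac:(lra)). field. lra.
Qed.

Lemma bessel_struve_coeff_pos (nu : R) (n : nat) : - 1 < nu ->
  0 < bessel_struve_coeff nu n.
Proof.
  intros Hnu. rewrite bessel_struve_coeff_ratio by exact Hnu.
  repeat apply Rmult_lt_0_compat.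
  - apply Gamma_pos. lra.
  - apply Rinv_0_lt_compat, sqrt_lt_R0, PI_RGT_0.
  - apply Gamma_pos. generalize (pos_INR n). lra.
  - apply Rinv_0_lt_compat, Gamma_pos. generalize (pos_INR n). lra.
  - apply Rinv_0_lt_compat, INR_fact_lt_0.
Qed.

Lemma bessel_struve_coeff_0 (nu : R) : - 1 < nu -> bessel_struve_coeff nu 0 = 1.
Proof.
  intros Hnu. rewrite bessel_struve_coeff_ratio by exact Hnu. unfold gamma_ratio.
  replace ((INR 0 + 1) / 2) with (1 / 2) by (simpl; field).
  replace (INR 0 / 2 + nu + 1) with (nu + 1) by (simpl; field).
  rewrite Gamma_half.
  assert (Hs := sqrt_lt_R0 PI PI_RGT_0). assert (Hg := Gamma_pos (nu + 1) ltac:(lra)).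
  simpl. field. lra.
Qed.

Lemma entire_bessel_struve_coeff (nu : R) :
  - (1 / 2) < nu -> entire (bessel_struve_coeff nu).
Proof.
  intros Hnu.
  apply entire_fact_bound
    with (Gamma (nu + 1) / sqrt PI * (gamma_ratio nu 0 + gamma_ratio nu 1)).
  intros n. rewrite Rabs_pos_eq by (apply Rlt_le, bessel_struve_coeff_pos; lra).
  rewrite bessel_struve_coeff_ratio by lra.
  apply Rmult_le_compat_r; [apply Rlt_le, Rinv_0_lt_compat, INR_fact_lt_0|].
  apply Rmult_le_compat_l; [|now apply gamma_ratio_bound].
  apply Rlt_le, Rdiv_lt_0_compat; [apply Gamma_pos; lra|apply sqrt_lt_R0, PI_RGT_0].
Qed.

Definition two_minus (c : nat -> R) (n : nat) : R :=
  match n with O => 2 - c O | S _ => - c n end.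

Lemma PS_decr_1_two_minus (c : nat -> R) (n : nat) :
  PS_decr_1 (two_minus c) n = PS_scal (-1) (PS_decr_1 c) n.
Proof.
  unfold PS_scal, PS_decr_1, scal; simpl; unfold mult; simpl. ring.
Qed.

Lemma entire_two_minus (c : nat -> R) : entire c -> entire (two_minus c).
Proof.
  intros Hc. unfold entire. rewrite <- CV_radius_decr_1.
  apply (entire_ext (PS_scal (-1) (PS_decr_1 c))).
  - intros n. symmetry. apply PS_decr_1_two_minus.
  - now apply entire_scal, entire_decr_1.
Qed.

Lemma CPS_two_minus (c : nat -> R) (z : C) : entire c ->
  CPS (two_minus c) z = (RtoC 2 - CPS c z)%C.
Proof.
  intros Hc.
  rewrite CPS_decr_1 by now apply entire_two_minus.
  rewrite (CPS_ext _ _ z (PS_decr_1_two_minus c)), CPS_scal by now apply entire_decr_1.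
  rewrite (CPS_decr_1 c) by exact Hc. simpl two_minus.
  rewrite RtoC_minus. ring.
Qed.

Lemma Q_fun_CPS (nu : R) : - (1 / 2) < nu ->
  Q_fun nu = CPS (PS_Int (two_minus (bessel_struve_coeff nu))).
Proof.
  intros Hnu. assert (Hc := entire_bessel_struve_coeff nu Hnu).
  set (c := bessel_struve_coeff nu) in *.
  assert (He := entire_two_minus c Hc). assert (HI := entire_Int _ He).
  extensionality z. unfold Q_fun.
  replace (fun t : C => (RtoC 2 - bessel_struve nu t)%C)
    with (CPS (PS_derive (PS_Int (two_minus c)))).
  - rewrite CInt_segment_CPS, (CPS_0 _ HI) by exact HI. simpl PS_Int. ring.
  - extensionality t. rewrite PS_derive_Int. now apply CPS_two_minus.
Qed.

(** The weight expands as [(n + 1 - alpha) * (lambda * n + 1) = lambda * n * (n - 1) + (2 * lambda -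
    lambda * alpha + 1) * n + (1 - alpha)], which gives the values at 1 of [c''], [c'] and [c].
    Passing from [c] to [2 - c] flips the sign and adds the weight [1 - alpha] at 0 twice. *)
Lemma PSeries_two_minus_criterion (c : nat -> R) (alpha lambda : R) : entire c ->
  PSeries (affmul 1 (1 - alpha) (affmul lambda 1 (two_minus c))) 1
  = 2 * (1 - alpha)
    - (lambda * PSeries (PS_derive (PS_derive c)) 1
       + (2 * lambda - lambda * alpha + 1) * PSeries (PS_derive c) 1
       + (1 - alpha) * PSeries c 1).
Proof.
  intros Hc. assert (Hc1 := entire_derive _ Hc). assert (He := entire_two_minus c Hc).
  assert (Hu : forall b, entire b -> entire (affmul 1 (1 - alpha) (affmul lambda 1 b)))
    by (intros; now apply entire_affine, entire_affine).
  assert (H0 : forall b, affmul 1 (1 - alpha) (affmul lambda 1 b) 0 = (1 - alpha) * b 0%nat)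
    by (intros b; unfold affmul; simpl; ring).
  assert (Hnmul : forall b, PSeries (nmul b) 1 = PSeries (PS_derive b) 1).
  { intros b. rewrite <- (PSeries_ext _ _ 1 (nmul_incr_derive b)), PSeries_incr_1. ring. }
  assert (E : PSeries (affmul 1 (1 - alpha) (affmul lambda 1 c)) 1
    = lambda * PSeries (PS_derive (PS_derive c)) 1
       + (2 * lambda - lambda * alpha + 1) * PSeries (PS_derive c) 1
       + (1 - alpha) * PSeries c 1).
  { rewrite PSeries_affine, Hnmul by now apply entire_affine.
    rewrite (PSeries_ext _ (affmul lambda (lambda + 1) (PS_derive c))).
    - rewrite !PSeries_affine, !Hnmul by assumption. ring.
    - intros n. unfold PS_derive, affmul. rewrite S_INR. ring. }
  rewrite <- E.
  rewrite PSeries_decr_1, (PSeries_decr_1 (affmul 1 (1 - alpha) (affmul lambda 1 c)))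
    by now apply entire_ex, Hu.
  rewrite (PSeries_ext (PS_decr_1 (affmul 1 (1 - alpha) (affmul lambda 1 (two_minus c))))
    (PS_scal (-1) (PS_decr_1 (affmul 1 (1 - alpha) (affmul lambda 1 c))))).
  - rewrite PSeries_scal, !H0. simpl two_minus. ring.
  - intros n. unfold PS_scal, PS_decr_1, affmul, two_minus, scal; simpl; unfold mult; simpl.
    ring.
Qed.

Theorem theorem2p4 (nu alpha lambda : R)
  (hnu : - (1 / 2) < nu)
  (halpha : 0 <= alpha < 1)
  (hlambda : 0 <= lambda < 1) :
  class_Lstar lambda alpha (Q_fun nu) <->
  lambda * Re (C_Derive_n 2 (bessel_struve nu) (RtoC 1))
  + (2 * lambda - lambda * alpha + 1)
    * Re (C_Derive_n 1 (bessel_struve nu) (RtoC 1))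
  + (1 - alpha) * Re (bessel_struve nu (RtoC 1))
  <= 2 * (1 - alpha).
Proof.
  assert (Hc := entire_bessel_struve_coeff nu hnu).
  rewrite Q_fun_CPS by exact hnu.
  change (bessel_struve nu) with (CPS (bessel_struve_coeff nu)).
  set (c := bessel_struve_coeff nu) in *.
  rewrite !(fun n => proj1 (C_Derive_n_CPS c n Hc)). cbn [Nat.iter nat_rect].
  rewrite !CPS_RtoC, !re_RtoC by auto using entire_derive.
  rewrite class_Lstar_CPS_Int, PSeries_two_minus_criterion;
    [lra|exact Hc|now apply entire_two_minus| | |exact halpha|lra].
  - unfold two_minus, c. rewrite bessel_struve_coeff_0 by lra. ring.
  - intros n. unfold two_minus.
    assert (H := bessel_struve_coeff_pos nu (S n) ltac:(lra)). fold c in H. lra.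
Qed.
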